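(* Let $k$ be a positive integer and let $z\in\mathbb{C}$ with $\Re(z)\ge 0$ and $z\ne 0$. Then $$|R_{k+1}(z)| \le \frac{\pi^{1/2}\,\Gamma(k+\frac12)}{\Gamma(k)}\,|T_k(z)|$$ and $$|R_{k}(z)| \le \left(\frac{\pi^{1/2}\,\Gamma(k+\frac12)}{\Gamma(k)} + 1\right)|T_k(z)|.$$
   Context: $\log$ is the principal branch of the logarithm on $\mathbb{C}\setminus(-\infty,0]$. $\ln\Gamma$ denotes the analytic function on $\mathbb{C}\setminus(-\infty,0]$ with $\exp(\ln\Gamma(z))=\Gamma(z)$ that is real and equal to $\log(\Gamma(x))$ for real $x>0$. $B_{2j}$ are the Bernoulli numbers ($B_2=\frac16$, $B_4=-\frac1{30}$, etc.). For integers $j\ge1$, $$T_j(z) = \frac{B_{2j}}{2j(2j-1)z^{2j-1}},$$ and for integers $k\ge 1$ the remainder $R_k(z)$ in Stirling's approximation is defined by $$\ln\Gamma(z) = (z-\tfrac12)\log z - z + \tfrac12\log(2\pi) + \sum_{j=1}^{k-1} T_j(z) + R_k(z).$$ *)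

(* Defs.v *)
(* Classical Stdlib reals with Coquelicot's complex numbers. *)
From Stdlib Require Import Reals List.
From Coquelicot Require Import Coquelicot.
Open Scope R_scope.

Definition Cexp (z : C) : C := (exp (Re z) * cos (Im z), exp (Re z) * sin (Im z)).

(* Principal argument, with values in (-PI, PI] for z <> 0. *)
Definition Carg (z : C) : R :=
  if Rle_dec 0 (Im z) then acos (Re z / Cmod z) else - acos (Re z / Cmod z).

Definition Clog (z : C) : C := (ln (Cmod z), Carg z).

(* The complement of the closed half-line (-oo, 0]. *)
Definition slit_plane (z : C) : Prop := ~ (Im z = 0 /\ Re z <= 0).

(* Euler's integral of t^(z-1) e^(-t) over (0, +oo), which converges for Re z > 0. *)
Definition Euler_integral (z : C) : C :=
  RInt_gen (V := C_R_CompleteNormedModule)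
    (fun t : R => (Cexp ((z - 1) * RtoC (ln t)) * RtoC (exp (- t)))%C)
    (at_right 0) (Rbar_locally p_infty).

Fixpoint rising (z : C) (n : nat) : C :=
  match n with
  | O => RtoC 1
  | S m => (rising z m * (z + RtoC (INR m)))%C
  end.

(* The meromorphic continuation of Euler's integral by the functional equation:
   Gamma(z) = Gamma(z+n) / (z (z+1) ... (z+n-1)), where n is the least natural
   number with Re z + n > 0 (so n = 0 when Re z > 0). *)
Definition Gamma (z : C) : C :=
  let n := Z.to_nat (up (- Re z)) in
  (Euler_integral (z + RtoC (INR n)) / rising z n)%C.

(* Gamma on the real axis, where its values are real. *)
Definition GammaR (x : R) : R := Re (Gamma (RtoC x)).

Definition is_lnGamma (f : C -> C) : Prop :=
  (forall z, slit_plane z ->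
     ex_derive (K := C_AbsRing) (V := C_NormedModule) f z) /\
  (forall z, slit_plane z -> Cexp (f z) = Gamma z) /\
  (forall x : R, 0 < x -> f (RtoC x) = RtoC (ln (GammaR x))).

(* The list B_0, ..., B_n, from B_0 = 1 and, for n >= 1,
   sum_(j <= n) binom(n+1, j) B_j = 0 (so that B_1 = -1/2). *)
Fixpoint bernoulli_list (n : nat) : list R :=
  match n with
  | O => 1 :: nil
  | S m =>
      let l := bernoulli_list m in
      l ++ (- sum_f_R0 (fun j => Binomial.C (S n) j * nth j l 0) m / INR (S n)) :: nil
  end.

Definition bernoulli (n : nat) : R := nth n (bernoulli_list n) 0.

Definition stirling_T (j : nat) (z : C) : C :=
  (RtoC (bernoulli (2 * j)) /
   (RtoC (INR (2 * j)) * RtoC (INR (2 * j - 1)) * z ^ (2 * j - 1)))%C.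

Definition stirling_R (lnGamma : C -> C) (k : nat) (z : C) : C :=
  (lnGamma z -
   ((z - RtoC (1 / 2)) * Clog z - z + RtoC (1 / 2 * ln (2 * PI)) +
    sum_n_m (G := C_AbelianMonoid) (fun j => stirling_T j z) 1 (k - 1)))%C.

(* Main.v *)
Require Import Defs.
From Stdlib Require Import Reals Lra Lia List Factorial.
From Coquelicot Require Import Coquelicot.
Open Scope R_scope.

(** The bound comes from a formula of Euler-Maclaurin type,
    [R_(k+1)(z) = - int_0^oo B_(2k)({u}) / (2k (u + z)^(2k)) du], valid for [Re z > 0].
    In modulus, [|B_(2k)({u})| <= |B_(2k)|] ([bernoulli_poly_even_le]) and
    [|u + z|^2 >= u^2 + |z|^2] on the right half-plane, so that
    [|R_(k+1)(z)| <= |B_(2k)| / (2k) * |z|^(1-2k) * int_0^oo du / (1 + u^2)^k].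
    The last integral is a Wallis integral, and its recurrence in [k] is that of
    [sqrt pi Gamma(k + 1/2) / Gamma(k)] up to the factor [2k - 1]
    ([wallis_const_Gamma]), which is the first inequality. The second one follows from
    [R_k = R_(k+1) + T_k].

    The improper integral is handled through finite sums. Write [S_k(z)] for the Stirling
    formula truncated after [T_k], without its constant. One step of the integral,
    over a unit interval, is the defect of [S_k] in the functional equation
    [lnGamma(w + 1) = lnGamma(w) + Log w], and it has an explicit primitive obtained by
    integrating by parts down the Bernoulli polynomials
    ([stirling_primitive_increment]). The mean value inequality bounds each step, and
    summing the steps over [w = z, ..., z + N - 1] bounds the difference between
    [S_k(z)] and [S_k(z + N) - sum_(n < N) Log(z + n)] ([stirling_approx_diff]).

    It remains to see that [S_0(z + N) - sum_(n < N) Log(z + n) + ln(2 pi) / 2] tends to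
    the given branch of log-Gamma ([stirling_shift_lim]). Its exponential tends to
    [Gamma(z)]: Euler's integral is the limit of Gauss's product ([Gamma_Gauss]),
    because replacing [e^(-t)] by [(1 - t/n)^n] costs [O(1/n)], and the factorial in
    Gauss's product is handled by the real Stirling formula ([stirling_defect_lim]),
    whose constant comes from the Wallis product, as does [Gamma(1/2) = sqrt pi]. Hence
    the limit and log-Gamma differ by a multiple of [2 i pi], which is 0 on the positive
    real axis and is carried to [z] by continuity along a vertical segment; the
    convergence is uniform on the half-plane, so the intermediate value theorem applies
    to a single continuous approximant.

    The imaginary axis is reached by letting [z + 1/n] tend to [z]. *)

(** * Componentwise calculus of complex-valued functions and sequences *)

Lemma C_eq (z w : C) : Re z = Re w -> Im z = Im w -> z = w.
Proof. destruct z, w; simpl; intros; congruence. Qed.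

Lemma Re_plus z w : Re (z + w)%C = Re z + Re w. Proof. reflexivity. Qed.
Lemma Im_plus z w : Im (z + w)%C = Im z + Im w. Proof. reflexivity. Qed.
Lemma Re_minus z w : Re (z - w)%C = Re z - Re w. Proof. reflexivity. Qed.
Lemma Im_minus z w : Im (z - w)%C = Im z - Im w. Proof. reflexivity. Qed.
Lemma Re_mult z w : Re (z * w)%C = Re z * Re w - Im z * Im w.
Proof. reflexivity. Qed.

Lemma Cmod_sqr z : Cmod z * Cmod z = Re z * Re z + Im z * Im z.
Proof. generalize (Cmod2_alt z); simpl; lra. Qed.

Lemma im_le_Cmod z : Rabs (Im z) <= Cmod z.
Proof.
eapply Rle_trans; [apply Rmax_r | apply Rmax_Cmod].
Qed.

Lemma Cmod_le_Re_Im z : Cmod z <= Rabs (Re z) + Rabs (Im z).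
Proof.
generalize (Rabs_pos (Re z)) (Rabs_pos (Im z)); intros.
apply Rsqr_incr_0; try apply Cmod_ge_0; try lra.
unfold Rsqr; rewrite Cmod_sqr.
assert (Re z * Re z = Rabs (Re z) * Rabs (Re z)) by apply Rsqr_abs.
assert (Im z * Im z = Rabs (Im z) * Rabs (Im z)) by apply Rsqr_abs.
nra.
Qed.

Lemma Cmod_triangle_minus z w : Cmod (z - w) <= Cmod z + Cmod w.
Proof. unfold Cminus; rewrite <- (Cmod_opp w); apply Cmod_triangle. Qed.

Lemma Re_pos_neq_0 (z : C) : 0 < Re z -> z <> 0%C.
Proof. intros H E; rewrite E in H; simpl in H; lra. Qed.

(** ** Limits of complex sequences *)

(** Limits are taken on real and imaginary parts, so that the theory of real limits
    applies to each component. *)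
Definition Clim (u : nat -> C) (l : C) : Prop :=
  is_lim_seq (fun n => Re (u n)) (Re l) /\ is_lim_seq (fun n => Im (u n)) (Im l).

Lemma Clim_const c : Clim (fun _ => c) c.
Proof. split; apply is_lim_seq_const. Qed.

Lemma Clim_ext_eventually u v l :
  eventually (fun n => u n = v n) -> Clim u l -> Clim v l.
Proof.
intros [N E] [H1 H2]; split.
- eapply is_lim_seq_ext_loc; [|exact H1]; exists N; intros; rewrite E; auto.
- eapply is_lim_seq_ext_loc; [|exact H2]; exists N; intros; rewrite E; auto.
Qed.

Lemma Clim_ext u v l : (forall n, u n = v n) -> Clim u l -> Clim v l.
Proof. intros E; apply Clim_ext_eventually; exists 0%nat; auto. Qed.

Lemma Clim_plus u v l m : Clim u l -> Clim v m -> Clim (fun n => u n + v n)%C (l + m)%C.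
Proof.
intros [H1 H2] [H3 H4]; split; simpl; apply is_lim_seq_plus'; assumption.
Qed.

Lemma Clim_minus u v l m : Clim u l -> Clim v m -> Clim (fun n => u n - v n)%C (l - m)%C.
Proof.
intros [H1 H2] [H3 H4]; split; simpl.
- apply (is_lim_seq_minus' _ _ (Re l) (Re m)); assumption.
- apply (is_lim_seq_minus' _ _ (Im l) (Im m)); assumption.
Qed.

Lemma Clim_mult u v l m : Clim u l -> Clim v m -> Clim (fun n => u n * v n)%C (l * m)%C.
Proof.
intros [H1 H2] [H3 H4]; split.
- apply (is_lim_seq_minus' (fun n => Re (u n) * Re (v n)) (fun n => Im (u n) * Im (v n))
    (Re l * Re m) (Im l * Im m)); apply is_lim_seq_mult'; assumption.
- apply (is_lim_seq_plus' (fun n => Re (u n) * Im (v n)) (fun n => Im (u n) * Re (v n))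
    (Re l * Im m) (Im l * Re m)); apply is_lim_seq_mult'; assumption.
Qed.

Lemma Clim_RtoC u l : is_lim_seq u (Finite l) -> Clim (fun n => RtoC (u n)) (RtoC l).
Proof. intros H; split; simpl; [exact H | apply is_lim_seq_const]. Qed.

Lemma Clim_unique u l m : Clim u l -> Clim u m -> l = m.
Proof.
intros [H1 H2] [H3 H4]; apply C_eq.
- apply is_lim_seq_unique in H1; apply is_lim_seq_unique in H3; congruence.
- apply is_lim_seq_unique in H2; apply is_lim_seq_unique in H4; congruence.
Qed.

Lemma is_lim_seq_cont (f : R -> R) u (l : R) :
  continuous f l -> is_lim_seq u l -> is_lim_seq (fun n => f (u n)) (f l).
Proof.
intros Hf Hu; apply is_lim_seq_continuous; auto.
apply continuity_pt_filterlim; exact Hf.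
Qed.

Lemma is_lim_seq_sqr u (l : R) : is_lim_seq u l -> is_lim_seq (fun n => u n ^ 2) (l ^ 2).
Proof.
intros H; simpl; rewrite Rmult_1_r.
apply is_lim_seq_ext with (fun n => u n * u n); [intros n; simpl; ring|].
apply is_lim_seq_mult'; exact H.
Qed.

Lemma Clim_Cmod u l : Clim u l -> is_lim_seq (fun n => Cmod (u n)) (Cmod l).
Proof.
intros [H1 H2].
apply (is_lim_seq_cont sqrt (fun n => Re (u n) ^ 2 + Im (u n) ^ 2)).
- apply continuous_sqrt.
- apply (is_lim_seq_plus' _ _ (Re l ^ 2) (Im l ^ 2)); apply is_lim_seq_sqr; assumption.
Qed.

Lemma Clim_of_Cmod u l : is_lim_seq (fun n => Cmod (u n - l)) 0 -> Clim u l.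
Proof.
intros H; split.
- apply is_lim_seq_ext with (fun n => Re (u n - l)%C + Re l).
  { intros n; rewrite Re_minus; ring. }
  replace (Finite (Re l)) with (Finite (0 + Re l)) by (f_equal; ring).
  apply is_lim_seq_plus'; [|apply is_lim_seq_const].
  apply is_lim_seq_abs_0, (is_lim_seq_le_le (fun _ => 0) _ (fun n => Cmod (u n - l)));
    auto using is_lim_seq_const.
  intros n; split; [apply Rabs_pos | apply re_le_Cmod].
- apply is_lim_seq_ext with (fun n => Im (u n - l)%C + Im l).
  { intros n; rewrite Im_minus; ring. }
  replace (Finite (Im l)) with (Finite (0 + Im l)) by (f_equal; ring).
  apply is_lim_seq_plus'; [|apply is_lim_seq_const].
  apply is_lim_seq_abs_0, (is_lim_seq_le_le (fun _ => 0) _ (fun n => Cmod (u n - l)));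
    auto using is_lim_seq_const.
  intros n; split; [apply Rabs_pos | apply im_le_Cmod].
Qed.

Lemma is_lim_seq_inv_INR : is_lim_seq (fun n => / INR n) 0.
Proof.
replace (Finite 0) with (Rbar_inv p_infty) by reflexivity.
apply is_lim_seq_inv; [apply is_lim_seq_INR | discriminate].
Qed.

Lemma Clim_of_rate u l K :
  (forall n, (1 <= n)%nat -> Cmod (u n - l) <= K / INR n) -> Clim u l.
Proof.
intros H; apply Clim_of_Cmod.
apply is_lim_seq_le_le_loc with (fun _ => 0) (fun n => K * / INR n).
- exists 1%nat; intros n Hn; split; [apply Cmod_ge_0 | apply H, Hn].
- apply is_lim_seq_const.
- replace (Finite 0) with (Finite (K * 0)) by (f_equal; ring).
  apply is_lim_seq_mult'; [apply is_lim_seq_const | apply is_lim_seq_inv_INR].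
Qed.

Lemma Clim_Cexp u l : Clim u l -> Clim (fun n => Cexp (u n)) (Cexp l).
Proof.
intros [H1 H2].
assert (He : is_lim_seq (fun n => exp (Re (u n))) (exp (Re l))).
{ apply is_lim_seq_cont; auto; apply continuity_pt_filterlim, derivable_continuous_pt, derivable_pt_exp. }
split; simpl; apply is_lim_seq_mult'; auto; apply is_lim_seq_cont; auto;
  [apply continuous_cos | apply continuous_sin].
Qed.

Lemma lim_le u v (l m : R) :
  is_lim_seq u l -> is_lim_seq v m -> eventually (fun n => u n <= v n) -> l <= m.
Proof.
intros Hu Hv H; exact (is_lim_seq_le_loc u v l m H Hu Hv).
Qed.

Lemma Clim_Cauchy_rate u K :
  (forall N M, (1 <= N <= M)%nat -> Cmod (u M - u N) <= K / INR N) ->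
  exists l, Clim u l /\ forall N, (1 <= N)%nat -> Cmod (l - u N) <= K / INR N.
Proof.
intros H.
assert (HC : forall g : C -> R, (forall z, Rabs (g z) <= Cmod z) ->
    (forall z w, g (z - w)%C = g z - g w) -> ex_finite_lim_seq (fun n => g (u n))).
{ intros g Hg1 Hg2; apply ex_lim_seq_cauchy_corr; intros eps.
  generalize is_lim_seq_inv_INR; intros HL.
  assert (HL2 : is_lim_seq (fun n => K * / INR n) 0).
  { replace (Finite 0) with (Finite (K * 0)) by (f_equal; ring).
    apply is_lim_seq_mult'; [apply is_lim_seq_const | exact HL]. }
  apply is_lim_seq_spec in HL2; destruct (HL2 eps) as [N0 HN].
  exists (S N0).
  assert (W : forall n m, (S N0 <= n <= m)%nat -> Rabs (g (u m) - g (u n)) < eps).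
  { intros n m Hnm; rewrite <- Hg2.
    eapply Rle_lt_trans; [apply Hg1|].
    eapply Rle_lt_trans; [apply H; lia|].
    eapply Rle_lt_trans; [|apply (HN n); lia].
    rewrite Rminus_0_r; apply Rle_abs. }
  intros n m Hn Hm; destruct (Nat.le_ge_cases n m).
  - rewrite Rabs_minus_sym; apply W; lia.
  - apply W; lia. }
destruct (HC Re re_le_Cmod (fun _ _ => eq_refl)) as [a Ha].
destruct (HC Im im_le_Cmod (fun _ _ => eq_refl)) as [b Hb].
assert (HL : Clim u (a, b)) by (split; assumption).
exists (a, b); split; auto.
intros N HN.
assert (HM := Clim_Cmod _ _ (Clim_minus _ _ _ _ HL (Clim_const (u N)))).
eapply lim_le; [exact HM | apply is_lim_seq_const |].
exists N; intros n Hn; apply H; lia.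
Qed.

(** ** The complex exponential and logarithm *)

Lemma Cexp_plus z w : Cexp (z + w) = (Cexp z * Cexp w)%C.
Proof.
destruct z, w; unfold Cexp; apply C_eq; simpl; rewrite exp_plus, ?cos_plus, ?sin_plus; ring.
Qed.

Lemma Cexp_RtoC x : Cexp (RtoC x) = RtoC (exp x).
Proof. unfold Cexp, RtoC; simpl; rewrite cos_0, sin_0; f_equal; ring. Qed.

Lemma Cexp_0 : Cexp 0 = 1%C.
Proof. rewrite Cexp_RtoC, exp_0; reflexivity. Qed.

Lemma Cmod_Cexp z : Cmod (Cexp z) = exp (Re z).
Proof.
apply Rsqr_inj; [apply Cmod_ge_0 | left; apply exp_pos | unfold Rsqr].
rewrite Cmod_sqr; simpl.
generalize (sin2_cos2 (Im z)); unfold Rsqr; intros.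
replace (exp (Re z) * exp (Re z)) with
  (exp (Re z) * exp (Re z) * (sin (Im z) * sin (Im z) + cos (Im z) * cos (Im z)))
  by (rewrite H; ring).
ring.
Qed.

Lemma Cexp_neq_0 z : Cexp z <> 0%C.
Proof. apply Cmod_gt_0; rewrite Cmod_Cexp; apply exp_pos. Qed.

Lemma Cexp_minus z w : Cexp (z - w) = (Cexp z / Cexp w)%C.
Proof.
replace (Cexp z) with (Cexp (z - w) * Cexp w)%C.
- field; apply Cexp_neq_0.
- rewrite <- Cexp_plus; f_equal; ring.
Qed.

Lemma Cexp_eq_1 z : Cexp z = 1%C -> Re z = 0 /\ exists m, Im z = 2 * PI * IZR m.
Proof.
intros H.
assert (HR : Re z = 0).
{ apply exp_inv; rewrite exp_0, <- Cmod_Cexp, H; apply Cmod_1. }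
split; auto.
assert (Hc : cos (Im z) = 1).
{ generalize (f_equal Re H); simpl; rewrite HR, exp_0; lra. }
assert (Hs : sin (Im z / 2) = 0).
{ replace (Im z) with (2 * (Im z / 2)) in Hc by field.
  rewrite cos_2a_sin in Hc; nra. }
destruct (sin_eq_0_0 _ Hs) as [m Hm]; exists m; lra.
Qed.

Lemma Carg_atan z : 0 < Re z -> Carg z = atan (Im z / Re z).
Proof.
intros Hz.
assert (HM : 0 < Cmod z) by (apply Cmod_gt_0, Re_pos_neq_0, Hz).
assert (Hq : 0 < Re z / Cmod z) by (apply Rdiv_lt_0_compat; assumption).
assert (HS := Cmod_sqr z).
unfold Carg; rewrite acos_atan by exact Hq.
replace (1 - (Re z / Cmod z)²) with ((Rabs (Im z) / Cmod z)²).
2:{ unfold Rsqr; apply Rmult_eq_reg_r with (Cmod z * Cmod z); [|nra].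
    field_simplify; try lra.
    replace (Rabs (Im z) ^ 2) with (Im z ^ 2)
      by (simpl; rewrite !Rmult_1_r; apply Rsqr_abs).
    simpl; lra. }
rewrite sqrt_Rsqr.
2:{ apply Rmult_le_pos; [apply Rabs_pos | left; apply Rinv_0_lt_compat, HM]. }
replace (Rabs (Im z) / Cmod z / (Re z / Cmod z)) with (Rabs (Im z) / Re z)
  by (field; lra).
destruct (Rle_dec 0 (Im z)) as [Hi|Hi].
- rewrite Rabs_pos_eq; auto.
- rewrite Rabs_left by lra; rewrite <- atan_opp; f_equal; field; lra.
Qed.

Lemma ln_Cmod (z : C) : z <> 0%C -> ln (Cmod z) = / 2 * ln (Re z ^ 2 + Im z ^ 2).
Proof.
intros H; assert (Hz : 0 < Cmod z) by (apply Cmod_gt_0, H).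
rewrite <- Cmod2_alt; simpl; rewrite Rmult_1_r, ln_mult by assumption; lra.
Qed.

Lemma Clog_eq z : 0 < Re z ->
  Clog z = (/ 2 * ln (Re z ^ 2 + Im z ^ 2), atan (Im z / Re z)).
Proof.
intros Hz; unfold Clog; rewrite Carg_atan, ln_Cmod; auto using Re_pos_neq_0.
Qed.

Lemma Clog_RtoC x : 0 < x -> Clog (RtoC x) = RtoC (ln x).
Proof.
intros Hx; unfold Clog; rewrite Carg_atan by exact Hx; simpl.
rewrite Cmod_R, Rabs_pos_eq by lra.
unfold Rdiv; rewrite Rmult_0_l, atan_0; reflexivity.
Qed.

Lemma Cexp_Clog z : 0 < Re z -> Cexp (Clog z) = z.
Proof.
intros Hz.
assert (HM : 0 < Cmod z) by (apply Cmod_gt_0, Re_pos_neq_0, Hz).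
unfold Cexp, Clog; simpl; rewrite exp_ln, Carg_atan by assumption.
assert (HC : Cmod z = Re z * sqrt (1 + (Im z / Re z)²)).
{ rewrite <- (sqrt_Rsqr (Re z)) at 1 by lra.
  rewrite <- sqrt_mult; [|apply Rle_0_sqr|generalize (Rle_0_sqr (Im z / Re z)); lra].
  unfold Cmod; f_equal; unfold Rsqr; fold (Re z) (Im z); field; lra. }
assert (0 < sqrt (1 + (Im z / Re z)²)).
{ apply sqrt_lt_R0; generalize (Rle_0_sqr (Im z / Re z)); lra. }
apply C_eq; simpl.
- rewrite cos_atan, HC; field; lra.
- rewrite sin_atan, HC; field; lra.
Qed.

(** ** Derivatives of curves in the complex plane *)

Definition Cderiv (f : R -> C) (t : R) (l : C) : Prop :=
  is_derive (fun s => Re (f s)) t (Re l) /\ is_derive (fun s => Im (f s)) t (Im l).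

Lemma Cderiv_ext f g t l : (forall s, f s = g s) -> Cderiv f t l -> Cderiv g t l.
Proof.
intros E [H1 H2]; split; (eapply is_derive_ext; [intros s; rewrite <- E; reflexivity|assumption]).
Qed.

Lemma is_derive_cont (f : R -> R) (t l : R) : is_derive f t l -> continuous f t.
Proof.
intros H; apply (ex_derive_continuous (K := R_AbsRing) (V := R_NormedModule)).
exists l; exact H.
Qed.

Lemma Cderiv_ext_loc f g t l :
  locally t (fun s => f s = g s) -> Cderiv f t l -> Cderiv g t l.
Proof.
intros E [H1 H2]; split.
- eapply is_derive_ext_loc; [|exact H1]; revert E; apply filter_imp; intros s E; congruence.
- eapply is_derive_ext_loc; [|exact H2]; revert E; apply filter_imp; intros s E; congruence.
Qed.

Lemma Cderiv_eq f t l m : Cderiv f t l -> l = m -> Cderiv f t m.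
Proof. intros H <-; exact H. Qed.

Lemma is_derive_cst (c t : R) : is_derive (fun _ => c) t 0.
Proof. auto_derive; auto. Qed.

Lemma Cderiv_const c t : Cderiv (fun _ => c) t 0.
Proof. split; apply is_derive_cst. Qed.

Lemma Cderiv_RtoC f t l : is_derive f t l -> Cderiv (fun s => RtoC (f s)) t (RtoC l).
Proof. intros H; split; simpl; [exact H | apply is_derive_cst]. Qed.

Lemma Cderiv_plus f g t l m :
  Cderiv f t l -> Cderiv g t m -> Cderiv (fun s => f s + g s)%C t (l + m)%C.
Proof.
intros [H1 H2] [H3 H4]; split.
- apply (is_derive_plus (fun s => Re (f s)) (fun s => Re (g s))); assumption.
- apply (is_derive_plus (fun s => Im (f s)) (fun s => Im (g s))); assumption.
Qed.

Lemma Cderiv_shift w t : Cderiv (fun s => w + RtoC s)%C t 1.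
Proof.
replace (RtoC 1) with (0 + RtoC 1)%C by ring.
apply Cderiv_plus; [apply Cderiv_const|].
apply Cderiv_RtoC, (is_derive_id (K := R_AbsRing)).
Qed.

Lemma Cderiv_minus f g t l m :
  Cderiv f t l -> Cderiv g t m -> Cderiv (fun s => f s - g s)%C t (l - m)%C.
Proof.
intros [H1 H2] [H3 H4]; split.
- apply (is_derive_minus (fun s => Re (f s)) (fun s => Re (g s))); assumption.
- apply (is_derive_minus (fun s => Im (f s)) (fun s => Im (g s))); assumption.
Qed.

Lemma Cderiv_mult f g t l m :
  Cderiv f t l -> Cderiv g t m -> Cderiv (fun s => f s * g s)%C t (l * g t + f t * m)%C.
Proof.
intros [H1 H2] [H3 H4].
assert (E1 := is_derive_mult _ _ _ _ _ H1 H3 Rmult_comm).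
assert (E2 := is_derive_mult _ _ _ _ _ H2 H4 Rmult_comm).
assert (E3 := is_derive_mult _ _ _ _ _ H1 H4 Rmult_comm).
assert (E4 := is_derive_mult _ _ _ _ _ H2 H3 Rmult_comm).
split.
- assert (E := is_derive_minus _ _ _ _ _ E1 E2).
  match type of E with is_derive _ _ ?v =>
    replace (Re (l * g t + f t * m)%C) with v; [exact E|] end.
  unfold minus, plus, opp, mult, Re, Im; simpl; unfold Re, Im; ring.
- assert (E := is_derive_plus _ _ _ _ _ E3 E4).
  match type of E with is_derive _ _ ?v =>
    replace (Im (l * g t + f t * m)%C) with v; [exact E|] end.
  unfold minus, plus, opp, mult, Re, Im; simpl; unfold Re, Im; ring.
Qed.

Lemma Cderiv_Cexp f t l : Cderiv f t l -> Cderiv (fun s => Cexp (f s)) t (l * Cexp (f t))%C.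
Proof.
intros [H1 H2].
assert (E1 := is_derive_comp exp _ _ _ _ (is_derive_exp _) H1).
assert (E2 := is_derive_comp cos _ _ _ _ (is_derive_cos _) H2).
assert (E3 := is_derive_comp sin _ _ _ _ (is_derive_sin _) H2).
split.
- assert (E := is_derive_mult _ _ _ _ _ E1 E2 Rmult_comm).
  match type of E with is_derive _ _ ?v =>
    replace (Re (l * Cexp (f t))%C) with v; [exact E|] end.
  unfold plus, mult, scal; simpl; unfold mult, Re, Im; simpl; unfold Re, Im; ring.
- assert (E := is_derive_mult _ _ _ _ _ E1 E3 Rmult_comm).
  match type of E with is_derive _ _ ?v =>
    replace (Im (l * Cexp (f t))%C) with v; [exact E|] end.
  unfold plus, mult, scal; simpl; unfold mult, Re, Im; simpl; unfold Re, Im; ring.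
Qed.

Lemma Cderiv_inv (f : R -> C) t l :
  f t <> 0%C -> Cderiv f t l -> Cderiv (fun s => / f s)%C t (- (l / (f t * f t)))%C.
Proof.
intros H0 [H1 H2].
assert (HM : 0 < Re (f t) ^ 2 + Im (f t) ^ 2).
{ rewrite <- Cmod2_alt; apply pow_lt, Cmod_gt_0, H0. }
assert (Ef : f t = (Re (f t), Im (f t))) by (destruct (f t); reflexivity).
assert (D1 : ex_derive (fun s => Re (f s)) t) by (eexists; exact H1).
assert (D2 : ex_derive (fun s => Im (f s)) t) by (eexists; exact H2).
assert (E1 := is_derive_unique _ _ _ H1).
assert (E2 := is_derive_unique _ _ _ H2).
assert (HZ : (l / (f t * f t))%C = (l * (/ f t) * (/ f t))%C) by (field; exact H0).
rewrite HZ; clear HZ.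
set (x := fun s => Re (f s)) in *; set (y := fun s => Im (f s)) in *.
assert (Hx : Derive (fun s => x s) t = Re l) by exact E1.
assert (Hy : Derive (fun s => y s) t = Im l) by exact E2.
change (0 < x t ^ 2 + y t ^ 2) in HM.
split.
- apply (is_derive_ext (fun s => x s / (x s ^ 2 + y s ^ 2))); [reflexivity|].
  auto_derive; [repeat split; auto; lra|].
  rewrite Hx, Hy, Ef; destruct l as [p q]; simpl; change (Re (f t)) with (x t); change (Im (f t)) with (y t).
  field; simpl in *; lra.
- apply (is_derive_ext (fun s => - y s / (x s ^ 2 + y s ^ 2))); [reflexivity|].
  auto_derive; [repeat split; auto; lra|].
  rewrite Hx, Hy, Ef; destruct l as [p q]; simpl; change (Re (f t)) with (x t); change (Im (f t)) with (y t).
  field; simpl in *; lra.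
Qed.

Lemma Cderiv_Clog (f : R -> C) t l :
  0 < Re (f t) -> Cderiv f t l -> Cderiv (fun s => Clog (f s)) t (l / f t)%C.
Proof.
intros H0 [H1 H2].
assert (Ef : f t = (Re (f t), Im (f t))) by (destruct (f t); reflexivity).
assert (D1 : ex_derive (fun s => Re (f s)) t) by (eexists; exact H1).
assert (D2 : ex_derive (fun s => Im (f s)) t) by (eexists; exact H2).
assert (E1 := is_derive_unique _ _ _ H1).
assert (E2 := is_derive_unique _ _ _ H2).
assert (Hp := H0).
apply (Cderiv_ext_loc (fun s => (/ 2 * ln (Re (f s) ^ 2 + Im (f s) ^ 2), atan (Im (f s) / Re (f s))))).
{ assert (HL : locally t (fun s => 0 < Re (f s)))
    by exact (is_derive_cont _ _ _ H1 _ (open_gt 0 _ H0)).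
  revert HL; apply filter_imp; intros s Hs; rewrite Clog_eq; auto. }
set (x := fun s => Re (f s)) in *; set (y := fun s => Im (f s)) in *.
assert (Hx : Derive (fun s => x s) t = Re l) by exact E1.
assert (Hy : Derive (fun s => y s) t = Im l) by exact E2.
change (0 < x t) in Hp.
assert (0 < x t ^ 2 + y t ^ 2) by (simpl; nra).
split.
- apply (is_derive_ext (fun s => / 2 * ln (x s ^ 2 + y s ^ 2))); [reflexivity|].
  auto_derive; [repeat split; auto; simpl in *; lra|].
  rewrite Hx, Hy, Ef; destruct l as [p q]; simpl; change (Re (f t)) with (x t); change (Im (f t)) with (y t).
  field; simpl in *; lra.
- apply (is_derive_ext (fun s => atan (y s / x s))); [reflexivity|].
  auto_derive; [repeat split; auto; simpl in *; lra|].
  rewrite Hx, Hy, Ef; destruct l as [p q]; simpl; change (Re (f t)) with (x t); change (Im (f t)) with (y t).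
  field; simpl in *; split; [lra|nra].
Qed.

Lemma Cderiv_cont f t l : Cderiv f t l ->
  continuous (fun s => Re (f s)) t /\ continuous (fun s => Im (f s)) t.
Proof.
intros [H1 H2]; split; eapply is_derive_cont; eassumption.
Qed.

Lemma incr_of_deriv (g dg : R -> R) a b : a <= b ->
  (forall t, a <= t <= b -> is_derive g t (dg t)) ->
  (forall t, a <= t <= b -> 0 <= dg t) -> g a <= g b.
Proof.
intros Hab Hd Hp.
destruct (MVT_gen g a b dg) as [c [Hc E]].
- intros t Ht; rewrite Rmin_left, Rmax_right in Ht by lra; apply Hd; lra.
- intros t Ht; rewrite Rmin_left, Rmax_right in Ht by lra.
  apply continuity_pt_filterlim, (is_derive_cont g t (dg t)), Hd; lra.
- rewrite Rmin_left, Rmax_right in Hc by lra.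
  assert (0 <= dg c * (b - a)) by (apply Rmult_le_pos; [apply Hp; lra | lra]).
  lra.
Qed.

(** The mean value inequality reduces to monotonicity of a real function by
    projecting the curve on the direction of the chord [f b - f a]. *)
Lemma Cmean_value_le (f df : R -> C) (g dg : R -> R) a b : a <= b ->
  (forall t, a <= t <= b -> Cderiv f t (df t)) ->
  (forall t, a <= t <= b -> is_derive g t (dg t)) ->
  (forall t, a <= t <= b -> Cmod (df t) <= dg t) ->
  Cmod (f b - f a) <= g b - g a.
Proof.
intros Hab Hf Hg Hle.
set (w := (f b - f a)%C).
assert (Hm : Cmod w * g a - (Re w * Re (f a) + Im w * Im (f a)) <=
             Cmod w * g b - (Re w * Re (f b) + Im w * Im (f b))).
{ apply (incr_of_deriv (fun t => Cmod w * g t - (Re w * Re (f t) + Im w * Im (f t)))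
    (fun t => Cmod w * dg t - (Re w * Re (df t) + Im w * Im (df t)))); auto.
  - intros t Ht; destruct (Hf t Ht) as [H1 H2].
    apply (is_derive_minus (V := R_NormedModule)).
    + apply is_derive_scal, Hg, Ht.
    + apply (is_derive_plus (V := R_NormedModule)); apply is_derive_scal;
      assumption.
  - intros t Ht; specialize (Hle t Ht).
    assert (Re w * Re (df t) + Im w * Im (df t) <= Cmod w * Cmod (df t)).
    { rewrite <- (Cmod_conj w), <- Cmod_mult.
      eapply Rle_trans; [|apply re_le_Cmod].
      eapply Rle_trans; [|apply Rle_abs].
      rewrite Re_mult; simpl; lra. }
    generalize (Cmod_ge_0 w); nra. }
assert (HS := Cmod_sqr w).
assert (Re w = Re (f b) - Re (f a)) by reflexivity.
assert (Im w = Im (f b) - Im (f a)) by reflexivity.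
destruct (Req_dec (Cmod w) 0) as [E|E].
- rewrite E.
  assert (g a <= g b); [|lra].
  apply (incr_of_deriv g dg); auto.
  intros t Ht; eapply Rle_trans; [apply Cmod_ge_0 | apply Hle, Ht].
- generalize (Cmod_ge_0 w); intros; nra.
Qed.

(** * Bernoulli polynomials *)

Lemma length_bernoulli_list n : length (bernoulli_list n) = S n.
Proof.
induction n as [|n IH]; [reflexivity|].
cbn [bernoulli_list]; rewrite length_app, IH; simpl; lia.
Qed.

Lemma nth_bernoulli_list n j : (j <= n)%nat -> nth j (bernoulli_list n) 0 = bernoulli j.
Proof.
induction 1 as [|n Hj IH]; [reflexivity|].
cbn [bernoulli_list]; rewrite app_nth1; [exact IH | rewrite length_bernoulli_list; lia].
Qed.

Lemma bernoulli_0 : bernoulli 0 = 1.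
Proof. reflexivity. Qed.

Lemma bernoulli_S n :
  bernoulli (S n) =
  - sum_f_R0 (fun j => Binomial.C (S (S n)) j * bernoulli j) n / INR (S (S n)).
Proof.
unfold bernoulli at 1; cbn [bernoulli_list].
rewrite app_nth2; rewrite length_bernoulli_list; [|lia].
rewrite Nat.sub_diag; cbn [nth].
do 2 f_equal; apply sum_eq; intros j Hj.
rewrite nth_bernoulli_list; auto.
Qed.

Definition bernoulli_poly (n : nat) (u : R) : R :=
  sum_f_R0 (fun j => Binomial.C n j * bernoulli j * u ^ (n - j)) n.

Lemma C_diag n : Binomial.C n n = 1.
Proof.
unfold Binomial.C; rewrite Nat.sub_diag; simpl; field; apply INR_fact_neq_0.
Qed.

Lemma C_S_diag n : Binomial.C (S n) n = INR (S n).
Proof.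
unfold Binomial.C; replace (S n - n)%nat with 1%nat by lia.
rewrite fact_simpl, mult_INR; simpl (fact 1); simpl (INR 1); field; apply INR_fact_neq_0.
Qed.

Lemma C_absorb n j : (j <= n)%nat ->
  Binomial.C (S n) j * INR (S n - j) = INR (S n) * Binomial.C n j.
Proof.
intros Hj; unfold Binomial.C.
replace (S n - j)%nat with (S (n - j)) by lia.
rewrite !fact_simpl, !mult_INR; field.
repeat split; try apply INR_fact_neq_0; apply not_0_INR; lia.
Qed.

Lemma bernoulli_poly_at_0 n : bernoulli_poly n 0 = bernoulli n.
Proof.
unfold bernoulli_poly; destruct n as [|n].
- simpl; rewrite C_diag; ring.
- rewrite tech5, C_diag, Nat.sub_diag, sum_eq_R0; [simpl; ring|].
  intros j Hj; rewrite pow_i by lia; ring.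
Qed.

Lemma bernoulli_poly_at_1 n : bernoulli_poly (S (S n)) 1 = bernoulli (S (S n)).
Proof.
unfold bernoulli_poly; rewrite tech5, C_diag, tech5, C_S_diag, !pow1.
rewrite (sum_eq _ (fun j => Binomial.C (S (S n)) j * bernoulli j)).
2:{ intros j Hj; rewrite pow1; ring. }
rewrite (bernoulli_S n); field; apply not_0_INR; lia.
Qed.

Lemma is_derive_sum_f_R0 (f df : nat -> R -> R) n u :
  (forall j, (j <= n)%nat -> is_derive (f j) u (df j u)) ->
  is_derive (fun v => sum_f_R0 (fun j => f j v) n) u (sum_f_R0 (fun j => df j u) n).
Proof.
induction n as [|n IH]; intros H; simpl; [apply H; lia|].
apply (is_derive_plus (V := R_NormedModule)); [apply IH; intros; apply H; lia | apply H; lia].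
Qed.

Lemma is_derive_bernoulli_poly n u :
  is_derive (bernoulli_poly (S n)) u (INR (S n) * bernoulli_poly n u).
Proof.
unfold bernoulli_poly; cbn [sum_f_R0].
replace (INR (S n) * _) with
  (sum_f_R0 (fun j => INR (S n) * (Binomial.C n j * bernoulli j * u ^ (n - j))) n + 0)
  by (rewrite scal_sum, Rplus_0_r; apply sum_eq; intros; ring).
apply (is_derive_plus (V := R_NormedModule)).
- apply (is_derive_sum_f_R0
    (fun j v => Binomial.C (S n) j * bernoulli j * v ^ (S n - j))
    (fun j v => INR (S n) * (Binomial.C n j * bernoulli j * v ^ (n - j)))).
  intros j Hj.
  rewrite <- !Rmult_assoc, <- (C_absorb n j Hj), (Nat.sub_succ_l j n Hj).
  replace (_ * u ^ (n - j)) with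
    (Binomial.C (S n) j * bernoulli j * (INR (S (n - j)) * 1 * u ^ (n - j))) by ring.
  apply is_derive_scal, (is_derive_pow (fun v => v) (S (n - j)) u 1).
  apply (is_derive_id (K := R_AbsRing)).
- rewrite Nat.sub_diag; apply (is_derive_cst (Binomial.C (S n) (S n) * bernoulli (S n) * 1)).
Qed.

Lemma const_of_deriv_0 (f : R -> R) : (forall t, is_derive f t 0) -> forall a b, f a = f b.
Proof.
intros H; assert (W : forall a b, a <= b -> f a = f b).
{ intros a b Hab; apply Rle_antisym.
  - apply (incr_of_deriv f (fun _ => 0)); auto with real.
  - enough (- f a <= - f b) by lra.
    apply (incr_of_deriv (fun t => - f t) (fun _ => 0)); auto with real.
    intros t _; generalize (is_derive_opp (V := R_NormedModule) f t 0 (H t)).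
    unfold opp; simpl; rewrite Ropp_0; auto. }
intros a b; destruct (Rle_dec a b); [|symmetry]; apply W; lra.
Qed.

(** An Appell sequence is determined by its derivatives up to one constant per
    degree, and that constant is read off one degree higher: it is the mean value
    over [0, 1], which vanishes for positive degree when the next polynomial takes
    equal values at 0 and 1. Symmetry and duplication are instances. *)
Lemma bernoulli_poly_unique (P : nat -> R -> R) :
  (forall u, P 0%nat u = 1) ->
  (forall n u, is_derive (P (S n)) u (INR (S n) * P n u)) ->
  (forall n, P (S (S n)) 1 = P (S (S n)) 0) ->
  forall n u, P n u = bernoulli_poly n u.
Proof.
intros H0 Hd H1.
induction n as [|n IH]; intros u.
{ rewrite H0; unfold bernoulli_poly; simpl; rewrite C_diag, bernoulli_0; ring. }
set (c := P (S n) 0 - bernoulli_poly (S n) 0).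
assert (Hc : forall v, P (S n) v - bernoulli_poly (S n) v = c).
{ intros v; apply (const_of_deriv_0 (fun v => P (S n) v - bernoulli_poly (S n) v)).
  intros t; replace 0 with (INR (S n) * P n t - INR (S n) * bernoulli_poly n t)
    by (rewrite IH; ring).
  apply (is_derive_minus (V := R_NormedModule)); [apply Hd | apply is_derive_bernoulli_poly]. }
assert (Hk : forall v w,
  P (S (S n)) v - bernoulli_poly (S (S n)) v - INR (S (S n)) * c * v =
  P (S (S n)) w - bernoulli_poly (S (S n)) w - INR (S (S n)) * c * w).
{ apply (const_of_deriv_0 (fun v =>
    P (S (S n)) v - bernoulli_poly (S (S n)) v - INR (S (S n)) * c * v)).
  intros t; replace 0 with
    (INR (S (S n)) * P (S n) t - INR (S (S n)) * bernoulli_poly (S n) t - INR (S (S n)) * c * 1)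
    by (rewrite <- (Hc t); ring).
  apply (is_derive_minus (V := R_NormedModule));
    [apply (is_derive_minus (V := R_NormedModule));
      [apply Hd | apply is_derive_bernoulli_poly]|].
  apply is_derive_scal, (is_derive_id (K := R_AbsRing)). }
specialize (Hk 1 0).
rewrite H1, bernoulli_poly_at_1, bernoulli_poly_at_0 in Hk.
assert (INR (S (S n)) <> 0) by (apply not_0_INR; lia).
assert (c = 0) by (apply Rmult_eq_reg_l with (INR (S (S n))); lra).
specialize (Hc u); lra.
Qed.

Lemma bernoulli_poly_symm n u : (-1) ^ n * bernoulli_poly n (1 - u) = bernoulli_poly n u.
Proof.
apply (bernoulli_poly_unique (fun n u => (-1) ^ n * bernoulli_poly n (1 - u))).
- intros v; unfold bernoulli_poly; simpl; rewrite C_diag, bernoulli_0; ring.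
- intros m v.
  replace (INR (S m) * ((-1) ^ m * bernoulli_poly m (1 - v)))
    with ((-1) ^ S m * (-1 * (INR (S m) * bernoulli_poly m (1 - v)))) by (cbn [pow]; ring).
  apply is_derive_scal.
  apply (is_derive_comp (bernoulli_poly (S m)) (fun s => 1 - s)).
  + apply is_derive_bernoulli_poly.
  + auto_derive; auto; ring.
- intros m; replace (1 - 1) with 0 by ring; replace (1 - 0) with 1 by ring.
  rewrite bernoulli_poly_at_1, bernoulli_poly_at_0; reflexivity.
Qed.

Lemma bernoulli_poly_dup n u :
  2 ^ n / 2 * (bernoulli_poly n (u / 2) + bernoulli_poly n ((u + 1) / 2)) =
  bernoulli_poly n u.
Proof.
apply (bernoulli_poly_unique (fun n u =>
  2 ^ n / 2 * (bernoulli_poly n (u / 2) + bernoulli_poly n ((u + 1) / 2)))).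
- intros v; unfold bernoulli_poly; simpl; rewrite C_diag, bernoulli_0; field.
- intros m v.
  replace (INR (S m) * _) with (2 ^ S m / 2 *
    (/ 2 * (INR (S m) * bernoulli_poly m (v / 2)) +
     / 2 * (INR (S m) * bernoulli_poly m ((v + 1) / 2)))) by (cbn [pow]; field).
  apply is_derive_scal, (is_derive_plus (V := R_NormedModule)).
  + apply (is_derive_comp (bernoulli_poly (S m)) (fun s => s / 2)).
    * apply is_derive_bernoulli_poly.
    * auto_derive; auto; field.
  + apply (is_derive_comp (bernoulli_poly (S m)) (fun s => (s + 1) / 2)).
    * apply is_derive_bernoulli_poly.
    * auto_derive; auto; field.
- intros m.
  replace ((1 + 1) / 2) with 1 by field; replace (0 / 2) with 0 by field.
  replace ((0 + 1) / 2) with (1 / 2) by field.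
  rewrite bernoulli_poly_at_1, bernoulli_poly_at_0; ring.
Qed.

Lemma pow_m1_odd k : (-1) ^ (2 * k + 1) = -1.
Proof. rewrite pow_add, pow_mult; replace ((-1) ^ 2) with 1 by ring; rewrite pow1; ring. Qed.

Lemma pow_m1_even k : (-1) ^ (2 * k) = 1.
Proof. rewrite pow_mult; replace ((-1) ^ 2) with 1 by ring; apply pow1. Qed.

Lemma bernoulli_odd k : bernoulli (2 * k + 3) = 0.
Proof.
generalize (bernoulli_poly_symm (2 * k + 3) 0).
rewrite Rminus_0_r; replace (2 * k + 3)%nat with (S (S (2 * k + 1))) by lia.
rewrite bernoulli_poly_at_1, bernoulli_poly_at_0; cbn [pow]; rewrite pow_m1_odd; lra.
Qed.

Lemma bernoulli_poly_odd_half k : bernoulli_poly (2 * k + 1) (1 / 2) = 0.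
Proof.
generalize (bernoulli_poly_symm (2 * k + 1) (1 / 2)).
rewrite pow_m1_odd; replace (1 - 1 / 2) with (1 / 2) by field; lra.
Qed.

Lemma convex_le_0 (g dg ddg : R -> R) a b :
  (forall t, is_derive g t (dg t)) -> (forall t, is_derive dg t (ddg t)) ->
  (forall t, a <= t <= b -> 0 <= ddg t) -> g a = 0 -> g b = 0 ->
  forall t, a <= t <= b -> g t <= 0.
Proof.
intros Hg Hdg Hp Ha Hb t Ht.
destruct (Rle_dec (g t) 0) as [|Hn]; [assumption|exfalso].
assert (MV : forall u v, u < v -> exists c, u <= c <= v /\ g v - g u = dg c * (v - u)).
{ intros u v Huv; destruct (MVT_gen g u v dg) as [c [Hc E]].
  - intros s _; apply Hg.
  - intros s _; apply continuity_pt_filterlim, (is_derive_cont g s (dg s)), Hg.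
  - exists c; rewrite Rmin_left, Rmax_right in Hc by lra; auto. }
assert (a <> t) by (intros ->; lra).
assert (b <> t) by (intros ->; lra).
destruct (MV a t) as [c1 [Hc1 E1]]; [lra|].
destruct (MV t b) as [c2 [Hc2 E2]]; [lra|].
assert (dg c1 <= dg c2).
{ apply (incr_of_deriv dg ddg); try lra.
  - intros; apply Hdg.
  - intros s Hs; apply Hp; lra. }
assert (0 < dg c1) by nra.
assert (dg c2 < 0) by nra.
lra.
Qed.

(** Sign pattern of the odd Bernoulli polynomials on the half period: since
    [B_(n+2)''] is a positive multiple of [B_n], a sign of [B_n] makes [B_(n+2)]
    convex or concave, and it vanishes at both 0 and 1/2. *)
Lemma bernoulli_poly_odd_sign k u :
  0 <= u <= 1 / 2 -> 0 <= (-1) ^ S k * bernoulli_poly (2 * k + 1) u.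
Proof.
revert u; induction k as [|k IH]; intros u Hu.
{ unfold bernoulli_poly; simpl sum_f_R0.
  rewrite (C_S_diag 0), (C_diag 1), bernoulli_0, bernoulli_S.
  unfold Binomial.C; simpl; rewrite bernoulli_0; lra. }
enough ((-1) ^ S k * bernoulli_poly (2 * S k + 1) u <= 0).
{ cbn [pow] in *; lra. }
replace (2 * S k + 1)%nat with (S (S (2 * k + 1))) by lia.
set (s := (-1) ^ S k) in *; set (n := (2 * k + 1)%nat) in *.
apply (convex_le_0 (fun v => s * bernoulli_poly (S (S n)) v)
  (fun v => s * (INR (S (S n)) * bernoulli_poly (S n) v))
  (fun v => s * (INR (S (S n)) * (INR (S n) * bernoulli_poly n v))) 0 (1 / 2)); auto.
- intros t; apply is_derive_scal, is_derive_bernoulli_poly.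
- intros t; apply is_derive_scal, is_derive_scal, is_derive_bernoulli_poly.
- intros t Ht; specialize (IH t Ht).
  replace (s * _) with (INR (S (S n)) * INR (S n) * (s * bernoulli_poly n t)) by ring.
  apply Rmult_le_pos; auto; apply Rmult_le_pos; apply pos_INR.
- rewrite bernoulli_poly_at_0; unfold n.
  replace (S (S (2 * k + 1))) with (2 * k + 3)%nat by lia; rewrite bernoulli_odd; ring.
- unfold n; replace (S (S (2 * k + 1))) with (2 * (S k) + 1)%nat by lia.
  rewrite bernoulli_poly_odd_half; ring.
Qed.

(** On the half period an even Bernoulli polynomial is monotone by the sign of its
    derivative, hence lies between its values at 0 and 1/2; duplication gives
    [B_n(1/2) = (2^(1-n) - 1) B_n], which is smaller than [B_n] in absolute value. *)
Lemma bernoulli_poly_even_le k u : (1 <= k)%nat -> 0 <= u <= 1 ->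
  Rabs (bernoulli_poly (2 * k) u) <= Rabs (bernoulli (2 * k)).
Proof.
intros Hk.
assert (W : forall v, 0 <= v <= 1 / 2 ->
  Rabs (bernoulli_poly (2 * k) v) <= Rabs (bernoulli (2 * k))).
{ intros v Hv; destruct k as [|k]; [lia|].
  replace (2 * S k)%nat with (S (2 * k + 1)) by lia.
  set (n := (2 * k + 1)%nat).
  set (s := (-1) ^ S k).
  assert (Hs : Rabs s = 1) by apply pow_1_abs.
  assert (Mono : forall x y, 0 <= x -> x <= y -> y <= 1 / 2 ->
    s * bernoulli_poly (S n) x <= s * bernoulli_poly (S n) y).
  { intros x y Hx Hxy Hy.
    apply (incr_of_deriv (fun v => s * bernoulli_poly (S n) v)
      (fun v => s * (INR (S n) * bernoulli_poly n v))); auto.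
    - intros t _; apply is_derive_scal, is_derive_bernoulli_poly.
    - intros t Ht; replace (s * _) with (INR (S n) * (s * bernoulli_poly n t)) by ring.
      apply Rmult_le_pos; [apply pos_INR | apply bernoulli_poly_odd_sign; lra]. }
  assert (M1 := Mono 0 v); assert (M2 := Mono v (1 / 2)).
  assert (D := bernoulli_poly_dup (S n) 0).
  replace (0 / 2) with 0 in D by field; replace ((0 + 1) / 2) with (1 / 2) in D by field.
  rewrite bernoulli_poly_at_0 in *.
  assert (H2 : 1 <= 2 ^ S n / 2).
  { cbn [pow]; assert (1 <= 2 ^ n) by (apply pow_R1_Rle; lra); lra. }
  rewrite <- (Rmult_1_l (Rabs (bernoulli_poly _ _))), <- (Rmult_1_l (Rabs (bernoulli _))).
  rewrite <- Hs, <- !Rabs_mult.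
  set (q := 2 ^ S n / 2) in *.
  assert (D' : q * (s * bernoulli_poly (S n) (1 / 2)) = (1 - q) * (s * bernoulli (S n)))
    by (apply (f_equal (Rmult s)) in D; lra).
  set (a := s * bernoulli (S n)) in *.
  set (b := s * bernoulli_poly (S n) (1 / 2)) in *.
  set (x := s * bernoulli_poly (S n) v) in *.
  assert (a <= x <= b) by (split; [apply M1 | apply M2]; lra).
  assert (a <= 0) by nra.
  assert (b <= - a) by nra.
  rewrite (Rabs_left1 a) by lra; apply Rabs_le; lra. }
intros Hu; destruct (Rle_dec u (1 / 2)).
- apply W; lra.
- rewrite <- bernoulli_poly_symm, pow_m1_even, Rmult_1_l; apply W; lra.
Qed.

(** * Euler-Maclaurin summation of the logarithm *)

Fixpoint Csum (f : nat -> C) (n : nat) : C :=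
  match n with
  | O => 0%C
  | S m => (Csum f m + f m)%C
  end.

Lemma Csum_ext f g n : (forall j, (j < n)%nat -> f j = g j) -> Csum f n = Csum g n.
Proof.
induction n as [|n IH]; intros H; simpl; [reflexivity|].
rewrite IH, H; auto.
Qed.

Definition stirling_lead (z : C) : C := ((z - RtoC (1 / 2)) * Clog z - z)%C.

Definition stirling_sum (k : nat) (z : C) : C := Csum (fun j => stirling_T (S j) z) k.

(** What the leading Stirling term at [z + N] predicts for the log-Gamma function at
    [z] through the functional equation, up to the constant [ln (2 pi) / 2]. *)
Definition stirling_shift (N : nat) (z : C) : C :=
  (stirling_lead (z + RtoC (INR N)) - Csum (fun n => Clog (z + RtoC (INR n))) N)%C.

Lemma RtoC_INR_S n : RtoC (INR (S n)) = (RtoC (INR n) + 1)%C.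
Proof. rewrite S_INR, RtoC_plus; reflexivity. Qed.

Lemma RtoC_neq_0 x : x <> 0 -> RtoC x <> 0%C.
Proof. intros H E; apply H, (f_equal Re E). Qed.

Lemma RtoC_INR_neq_0 n : n <> 0%nat -> RtoC (INR n) <> 0%C.
Proof. intros H; apply RtoC_neq_0, not_0_INR, H. Qed.

Lemma Re_shift z n : Re (z + RtoC n)%C = Re z + n.
Proof. reflexivity. Qed.

Lemma Im_shift z n : Im (z + RtoC n)%C = Im z.
Proof. destruct z; simpl; ring. Qed.

(** The Bernoulli numbers of odd index at least 3 vanish, so the boundary terms of
    repeated integration by parts pair up into the Stirling terms. *)
Lemma stirling_sum_bernoulli k (v : C) : v <> 0%C ->
  Csum (fun m => RtoC (bernoulli (S (S m)) / (INR (S (S m)) * INR (S m))) * (/ v) ^ (S m))%C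
    (2 * k + 1) = stirling_sum (S k) v.
Proof.
intros Hv.
assert (HT : forall j, stirling_T (S j) v =
  (RtoC (bernoulli (S (S (2 * j))) / (INR (S (S (2 * j))) * INR (S (2 * j)))) *
   (/ v) ^ (S (2 * j)))%C).
{ intros j; unfold stirling_T.
  replace (2 * S j)%nat with (S (S (2 * j))) by lia.
  replace (S (S (2 * j)) - 1)%nat with (S (2 * j)) by lia.
  rewrite RtoC_div, RtoC_mult, Cpow_inv by
    (auto using Rmult_integral_contrapositive_currified, not_0_INR).
  field; repeat split; try (apply Cpow_nz, Hv); apply RtoC_INR_neq_0; lia. }
induction k as [|k IH].
- unfold stirling_sum; cbn [Csum Nat.mul Nat.add]; rewrite HT; reflexivity.
- replace (2 * S k + 1)%nat with (S (S (2 * k + 1))) by lia.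
  cbn [Csum]; rewrite IH.
  change (stirling_sum (S (S k)) v) with (stirling_sum (S k) v + stirling_T (S (S k)) v)%C.
  rewrite (HT (S k)).
  replace (2 * S k)%nat with (S (2 * k + 1)) by lia.
  replace (S (S (2 * k + 1))) with (2 * k + 3)%nat by lia.
  rewrite bernoulli_odd.
  unfold Rdiv; rewrite Rmult_0_l; ring.
Qed.

Lemma Cderiv_inv_pow (w : C) m u : 0 < Re w + u ->
  Cderiv (fun s => (/ (w + RtoC s)) ^ m)%C u
    (- (RtoC (INR m) * (/ (w + RtoC u)) ^ (S m)))%C.
Proof.
intros Hu.
assert (Hn : (w + RtoC u)%C <> 0%C) by (apply Re_pos_neq_0; exact Hu).
induction m as [|m IH].
- apply (Cderiv_ext (fun _ => 1%C)); [reflexivity|].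
  eapply Cderiv_eq; [apply Cderiv_const|]; simpl INR; ring.
- eapply Cderiv_eq.
  + apply (Cderiv_mult (fun s => / (w + RtoC s))%C (fun s => (/ (w + RtoC s)) ^ m)%C);
      [|exact IH].
    apply Cderiv_inv; [exact Hn | apply Cderiv_shift].
  + rewrite RtoC_INR_S; rewrite !Cpow_S; field; exact Hn.
Qed.

(** [bern_term w m] is a primitive of the difference of two consecutive kernels
    [B_n(u) / (n (w + u)^n)], because [B_n' = n B_(n-1)]: summing over [m] is repeated
    integration by parts. *)
Definition bern_term (w : C) (m : nat) (u : R) : C :=
  (RtoC (bernoulli_poly (S (S m)) u / (INR (S (S m)) * INR (S m))) *
   (/ (w + RtoC u)) ^ (S m))%C.

Definition bern_kernel (w : C) (n : nat) (u : R) : C :=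
  (RtoC (bernoulli_poly n u / INR n) * (/ (w + RtoC u)) ^ n)%C.

Lemma Cderiv_bern_term w m u : 0 < Re w + u ->
  Cderiv (bern_term w m) u (bern_kernel w (S m) u - bern_kernel w (S (S m)) u)%C.
Proof.
intros Hu.
assert (Hn : (w + RtoC u)%C <> 0%C) by (apply Re_pos_neq_0; exact Hu).
eapply Cderiv_eq.
- apply Cderiv_mult; [|apply Cderiv_inv_pow, Hu].
  apply Cderiv_RtoC.
  apply (is_derive_ext (fun s => / (INR (S (S m)) * INR (S m)) * bernoulli_poly (S (S m)) s)).
  { intros; unfold Rdiv; apply Rmult_comm. }
  apply is_derive_scal, is_derive_bernoulli_poly.
- unfold bern_kernel.
  assert (INR (S (S m)) <> 0) by (apply not_0_INR; lia).
  assert (INR (S m) <> 0) by (apply not_0_INR; lia).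
  rewrite !RtoC_mult, !RtoC_div, !RtoC_inv, !RtoC_mult by auto using Rmult_integral_contrapositive_currified.
  rewrite !Cpow_S; field; repeat split; auto using RtoC_neq_0.
Qed.

Lemma Cderiv_bern_sum w M u : 0 < Re w + u ->
  Cderiv (fun s => Csum (fun m => bern_term w m s) M) u
    (bern_kernel w 1 u - bern_kernel w (S M) u)%C.
Proof.
intros Hu; induction M as [|M IH].
- apply (Cderiv_ext (fun _ => 0%C)); [reflexivity|].
  eapply Cderiv_eq; [apply Cderiv_const | ring].
- eapply Cderiv_eq; [apply Cderiv_plus; [exact IH | apply Cderiv_bern_term, Hu]|].
  ring.
Qed.

(** A primitive of the kernel of index [2 k + 2]: the first two terms integrate the
    kernel of index 1, the sum carries it down to the last one. Its increment over
    [[0, 1]] is the defect of the truncated Stirling formula in the functional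
    equation. *)
Definition stirling_primitive (k : nat) (w : C) (u : R) : C :=
  (RtoC u - (w + RtoC (1 / 2)) * Clog (w + RtoC u)
   - Csum (fun m => bern_term w m u) (2 * k + 1))%C.

Lemma Cderiv_stirling_primitive k w u : 0 < Re w -> 0 <= u ->
  Cderiv (stirling_primitive k w) u (bern_kernel w (2 * S k) u).
Proof.
intros Hw Hu.
assert (Hn : (w + RtoC u)%C <> 0%C) by (apply Re_pos_neq_0; rewrite Re_shift; lra).
eapply Cderiv_eq.
- apply Cderiv_minus; [|apply Cderiv_bern_sum; lra].
  apply Cderiv_minus; [apply (Cderiv_RtoC (fun s => s) u 1), (is_derive_id (K := R_AbsRing))|].
  apply Cderiv_mult; [apply Cderiv_const|].
  apply Cderiv_Clog; [rewrite Re_shift; lra|].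
  apply Cderiv_shift.
- replace (S (2 * k + 1)) with (2 * S k)%nat by lia.
  unfold bern_kernel at 1.
  replace (bernoulli_poly 1 u) with (u - 1 / 2).
  2:{ unfold bernoulli_poly; simpl sum_f_R0.
      rewrite (C_S_diag 0), (C_diag 1), bernoulli_0, bernoulli_S.
      unfold Binomial.C; simpl; rewrite bernoulli_0; field. }
  replace ((u - 1 / 2) / INR 1) with (u - 1 / 2) by (simpl; field).
  rewrite RtoC_minus, Cpow_S.
  change ((/ (w + RtoC u)) ^ 0)%C with (RtoC 1).
  set (h := RtoC (1 / 2)); field; exact Hn.
Qed.

Lemma stirling_primitive_increment k w : 0 < Re w ->
  (stirling_primitive k w 1 - stirling_primitive k w 0)%C =
  (Clog w - (stirling_lead (w + 1) + stirling_sum (S k) (w + 1)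
             - stirling_lead w - stirling_sum (S k) w))%C.
Proof.
intros Hw.
assert (Hs : forall u, 0 <= u -> (u = 0 \/ u = 1) -> Csum (fun m => bern_term w m u) (2 * k + 1)
  = stirling_sum (S k) (w + RtoC u)).
{ intros u Hu H01.
  rewrite <- stirling_sum_bernoulli by (apply Re_pos_neq_0; rewrite Re_shift; lra).
  apply Csum_ext; intros m _; unfold bern_term; do 3 f_equal.
  destruct H01 as [-> | ->]; [apply bernoulli_poly_at_0 | apply bernoulli_poly_at_1]. }
unfold stirling_primitive; rewrite !Hs by (auto; lra).
replace (w + RtoC 0)%C with w by ring.
unfold stirling_lead.
set (h := RtoC (1 / 2)).
assert (Hh : RtoC 1 = (h + h)%C) by (unfold h; rewrite <- RtoC_plus; f_equal; field).
replace (w + h)%C with (w - h + 1)%C by (rewrite Hh; ring); ring.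
Qed.

(** ** Comparison of the shifted approximants *)

Definition stirling_approx (k N : nat) (z : C) : C :=
  (stirling_shift N z + stirling_sum k (z + RtoC (INR N)))%C.

Lemma Cmod_shift_ge (z : C) v : 0 <= Re z -> 0 <= v ->
  v ^ 2 + Cmod z ^ 2 <= Cmod (z + RtoC v) ^ 2.
Proof.
intros Hz Hv; rewrite !Cmod2_alt, Re_shift, Im_shift; nra.
Qed.

(** The one-step error is bounded by integrating the kernel in modulus: on the right
    half-plane [|z + v|^2 >= v^2 + |z|^2], and a Bernoulli polynomial of even index is
    largest in modulus at 0. *)
Lemma stirling_approx_step k N (z : C) (G : R -> R) : 0 < Re z ->
  (forall v, 0 <= v -> is_derive G v (/ (v ^ 2 + Cmod z ^ 2) ^ (S k))) ->
  Cmod (stirling_approx (S k) (S N) z - stirling_approx (S k) N z) <=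
  Rabs (bernoulli (2 * S k)) / INR (2 * S k) * (G (INR (S N)) - G (INR N)).
Proof.
intros Hz HG.
set (w := (z + RtoC (INR N))%C).
assert (HN := pos_INR N).
assert (Hw : 0 < Re w) by (unfold w; rewrite Re_shift; lra).
assert (Hr : 0 < Cmod z) by (apply Cmod_gt_0, Re_pos_neq_0, Hz).
assert (E : (stirling_approx (S k) (S N) z - stirling_approx (S k) N z)%C =
  (- (stirling_primitive k w 1 - stirling_primitive k w 0))%C).
{ rewrite stirling_primitive_increment by exact Hw.
  unfold stirling_approx, stirling_shift; cbn [Csum].
  replace (z + RtoC (INR (S N)))%C with (w + 1)%C by (unfold w; rewrite RtoC_INR_S; ring).
  fold w; ring. }
rewrite E, Cmod_opp.
set (c := Rabs (bernoulli (2 * S k)) / INR (2 * S k)).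
assert (Hn : 0 < INR (2 * S k)) by (apply lt_0_INR; lia).
replace (c * _) with (c * G (INR N + 1) - c * G (INR N + 0))
  by (rewrite S_INR, Rplus_0_r; ring).
apply (Cmean_value_le (stirling_primitive k w) (bern_kernel w (2 * S k))
  (fun u => c * G (INR N + u))
  (fun u => c * / ((INR N + u) ^ 2 + Cmod z ^ 2) ^ (S k))); [lra| | |].
- intros u Hu; apply Cderiv_stirling_primitive; auto; lra.
- intros u Hu; apply is_derive_scal.
  replace (/ _) with (1 * / ((INR N + u) ^ 2 + Cmod z ^ 2) ^ (S k)) by ring.
  apply (is_derive_comp G (fun u => INR N + u)); [apply HG; lra|].
  auto_derive; auto; ring.
- intros u Hu; unfold bern_kernel.
  rewrite Cmod_mult, Cmod_R, Cmod_pow, Cmod_inv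
    by (apply Re_pos_neq_0; rewrite Re_shift; lra).
  unfold c, Rdiv; rewrite Rabs_mult, (Rabs_pos_eq (/ _)) by (left; apply Rinv_0_lt_compat, Hn).
  rewrite !Rmult_assoc; apply Rmult_le_compat; try apply Rabs_pos.
  + apply Rmult_le_pos; [left; apply Rinv_0_lt_compat, Hn|].
    apply pow_le; left; apply Rinv_0_lt_compat, Cmod_gt_0, Re_pos_neq_0.
    rewrite Re_shift; lra.
  + apply bernoulli_poly_even_le; [lia | lra].
  + apply Rmult_le_compat_l; [left; apply Rinv_0_lt_compat, Hn|].
    assert (HQ : 0 < (INR N + u) ^ 2 + Cmod z ^ 2) by nra.
    rewrite pow_inv, pow_mult; apply Rinv_le_contravar; [apply pow_lt, HQ|].
    apply pow_incr; split; [lra|].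
    unfold w; rewrite <- Cplus_assoc, <- RtoC_plus.
    apply Cmod_shift_ge; lra.
Qed.

Lemma stirling_approx_diff k N M (z : C) (G : R -> R) : 0 < Re z -> (N <= M)%nat ->
  (forall v, 0 <= v -> is_derive G v (/ (v ^ 2 + Cmod z ^ 2) ^ (S k))) ->
  Cmod (stirling_approx (S k) M z - stirling_approx (S k) N z) <=
  Rabs (bernoulli (2 * S k)) / INR (2 * S k) * (G (INR M) - G (INR N)).
Proof.
intros Hz HNM HG; induction HNM as [|M HNM IH].
- replace (_ - _)%C with (RtoC 0) by ring; rewrite Cmod_0; lra.
- replace (stirling_approx (S k) (S M) z - stirling_approx (S k) N z)%C with
    ((stirling_approx (S k) (S M) z - stirling_approx (S k) M z) +
     (stirling_approx (S k) M z - stirling_approx (S k) N z))%C by ring.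
  eapply Rle_trans; [apply Cmod_triangle|].
  generalize (stirling_approx_step k M z G Hz HG); lra.
Qed.

Lemma Cmod_stirling_T j (z : C) : z <> 0%C ->
  Cmod (stirling_T (S j) z) =
  Rabs (bernoulli (2 * S j)) / (INR (2 * S j) * INR (2 * S j - 1) * Cmod z ^ (2 * S j - 1)).
Proof.
intros Hz; unfold stirling_T.
assert (H1 : INR (2 * S j) <> 0) by (apply not_0_INR; lia).
assert (H2 : INR (2 * S j - 1) <> 0) by (apply not_0_INR; lia).
rewrite Cmod_div, !Cmod_mult, !Cmod_R, Cmod_pow.
- rewrite !(Rabs_pos_eq (INR _)) by apply pos_INR; reflexivity.
- apply Cmult_neq_0; [apply Cmult_neq_0; apply RtoC_neq_0; assumption | apply Cpow_nz, Hz].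
Qed.

Lemma stirling_sum_shift_rate k : exists K, 0 <= K /\ forall (z : C) N, 0 < Re z -> (1 <= N)%nat ->
  Cmod (stirling_sum k (z + RtoC (INR N))) <= K / INR N.
Proof.
induction k as [|k [K [HK IH]]].
- exists 0; split; [lra|]; intros z N Hz HN; unfold stirling_sum; simpl.
  rewrite Cmod_0; unfold Rdiv; lra.
- set (b := Rabs (bernoulli (2 * S k))).
  exists (K + b); split; [generalize (Rabs_pos (bernoulli (2 * S k))); unfold b; lra|].
  intros z N Hz HN; unfold stirling_sum; cbn [Csum].
  eapply Rle_trans; [apply Cmod_triangle|].
  assert (H1 : 1 <= INR N) by (apply (le_INR 1); exact HN).
  set (w := (z + RtoC (INR N))%C).
  assert (Hw : INR N <= Cmod w).
  { eapply Rle_trans; [|apply re_le_Cmod]; unfold w; rewrite Re_shift.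
    rewrite Rabs_pos_eq; lra. }
  replace ((K + b) / INR N) with (K / INR N + b / INR N) by (field; lra).
  apply Rplus_le_compat; [apply IH; auto|].
  rewrite Cmod_stirling_T by (apply Re_pos_neq_0; unfold w; rewrite Re_shift; lra).
  apply Rmult_le_compat_l; [apply Rabs_pos|].
  apply Rinv_le_contravar; [lra|].
  assert (A1 : 1 <= INR (2 * S k)) by (apply (le_INR 1); lia).
  assert (A2 : 1 <= INR (2 * S k - 1)) by (apply (le_INR 1); lia).
  assert (A3 : Cmod w <= Cmod w ^ (2 * S k - 1)).
  { rewrite <- (pow_1 (Cmod w)) at 1; apply Rle_pow; [lra | lia]. }
  assert (1 <= INR (2 * S k) * INR (2 * S k - 1)) by nra.
  nra.
Qed.

(** The case [k = 1] of the comparison, with the first Stirling term discarded since it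
    is itself [O(1/N)]. The uniformity in [z] is what later lets one continuous
    approximant stand for the limit along a whole segment. *)
Lemma stirling_shift_Cauchy : exists K, forall (z : C) N M, 0 < Re z -> (1 <= N <= M)%nat ->
  Cmod (stirling_shift M z - stirling_shift N z) <= K / INR N.
Proof.
destruct (stirling_sum_shift_rate 1) as [K [HK HT]].
set (c := Rabs (bernoulli 2) / INR 2).
assert (Hc : 0 <= c).
{ apply Rmult_le_pos; [apply Rabs_pos | left; apply Rinv_0_lt_compat; simpl; lra]. }
exists (c + 2 * K); intros z N M Hz HNM.
set (r := Cmod z).
assert (Hr : 0 < r) by (apply Cmod_gt_0, Re_pos_neq_0, Hz).
assert (H1 : 1 <= INR N) by (apply (le_INR 1); lia).
assert (H2 : INR N <= INR M) by (apply le_INR; lia).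
assert (HG : forall v, 0 <= v ->
  is_derive (fun v => atan (v / r) / r) v (/ (v ^ 2 + r ^ 2) ^ 1)).
{ intros v Hv; auto_derive; auto; simpl; field; split; [nra | lra]. }
assert (D := stirling_approx_diff 0 N M z _ Hz (proj2 HNM) HG); fold c in D.
assert (HA : atan (INR M / r) / r - atan (INR N / r) / r <= / INR N).
{ assert (atan (INR M / r) / r + / INR M <= atan (INR N / r) / r + / INR N).
  2:{ assert (0 < / INR M) by (apply Rinv_0_lt_compat; lra); lra. }
  enough (- (atan (INR N / r) / r + / INR N) <= - (atan (INR M / r) / r + / INR M)) by lra.
  apply (incr_of_deriv (fun v => - (atan (v / r) / r + / v))
    (fun v => / v ^ 2 - / (v ^ 2 + r ^ 2))); auto.
  - intros v Hv; auto_derive; [lra|]; simpl; field; repeat split; nra.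
  - intros v Hv; assert (/ (v ^ 2 + r ^ 2) <= / v ^ 2) by (apply Rinv_le_contravar; nra).
    lra. }
replace (stirling_shift M z - stirling_shift N z)%C with
  ((stirling_approx 1 M z - stirling_approx 1 N z) -
   (stirling_sum 1 (z + RtoC (INR M)) - stirling_sum 1 (z + RtoC (INR N))))%C
  by (unfold stirling_approx; ring).
eapply Rle_trans; [apply Cmod_triangle_minus|].
assert (B1 := Cmod_triangle_minus (stirling_sum 1 (z + RtoC (INR M)))
  (stirling_sum 1 (z + RtoC (INR N)))).
assert (B2 := HT z N Hz (proj1 HNM)).
assert (B3 : Cmod (stirling_sum 1 (z + RtoC (INR M))) <= K / INR N).
{ eapply Rle_trans; [apply HT; auto; lia|].
  apply Rmult_le_compat_l; auto; apply Rinv_le_contravar; lra. }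
replace ((c + 2 * K) / INR N) with (c * / INR N + (K / INR N + K / INR N)) by (field; lra).
assert (c * (atan (INR M / r) / r - atan (INR N / r) / r) <= c * / INR N)
  by (apply Rmult_le_compat_l; auto).
change (2 * 1)%nat with 2%nat in D; fold c in D; lra.
Qed.

(** * Wallis integrals *)

(** [int_0^oo du / (1 + u^2)^(k + 1)]. *)
Fixpoint wallis_const (k : nat) : R :=
  match k with
  | O => PI / 2
  | S m => (2 * INR m + 1) / (2 * INR m + 2) * wallis_const m
  end.

(** By the reduction of [int dv / (v^2 + r^2)^(k + 2)] to the exponent [k + 1]; its
    boundary term is absorbed in the error [d / v]. *)
Lemma wallis_primitive r k : 0 < r -> exists G d,
  (forall v, is_derive G v (/ (v ^ 2 + r ^ 2) ^ (S k))) /\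
  (forall v, 0 < v -> G v - G 0 <= wallis_const k / r ^ (2 * k + 1) + d / v).
Proof.
intros Hr; induction k as [|k [G [d [HG Hb]]]].
- exists (fun v => atan (v / r) / r), 0; split.
  + intros v; auto_derive; auto; simpl; field; split; [nra | lra].
  + intros v Hv; replace (0 / r) with 0 by (field; lra); rewrite atan_0.
    assert (atan (v / r) < PI / 2) by apply atan_bound.
    assert (atan (v / r) / r <= (PI / 2) / r).
    { apply Rmult_le_compat_r; [left; apply Rinv_0_lt_compat, Hr | lra]. }
    simpl; unfold Rdiv in *; rewrite Rmult_1_r; lra.
- set (K := INR (S k)).
  assert (HK : 1 <= K) by (apply (le_INR 1); lia).
  assert (Hk : INR k = K - 1) by (unfold K; rewrite S_INR; ring).
  assert (Hr2 : 0 < r ^ 2) by (apply pow_lt, Hr).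
  assert (Hrk : 0 < (r ^ 2) ^ k) by (apply pow_lt, Hr2).
  assert (HQ : forall v, 0 < v ^ 2 + r ^ 2) by (intros; nra).
  exists (fun v => / (2 * K * r ^ 2) * (v * / (v ^ 2 + r ^ 2) ^ (S k) + (2 * K - 1) * G v)),
    (/ (2 * K * r ^ 2) * (/ (r ^ 2) ^ k + (2 * K - 1) * d)).
  split.
  + intros v; specialize (HQ v).
    replace (/ (v ^ 2 + r ^ 2) ^ S (S k)) with
      (/ (2 * K * r ^ 2) * ((1 * / (v ^ 2 + r ^ 2) ^ (S k) +
         v * - ((K * (2 * v) * (v ^ 2 + r ^ 2) ^ k) / ((v ^ 2 + r ^ 2) ^ (S k)) ^ 2))
       + (2 * K - 1) * / (v ^ 2 + r ^ 2) ^ (S k))).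
    2:{ assert (HP : 0 < (v ^ 2 + r ^ 2) ^ k) by (apply pow_lt, HQ).
        set (P := (v ^ 2 + r ^ 2) ^ k) in *.
        replace ((v ^ 2 + r ^ 2) ^ S k) with ((v ^ 2 + r ^ 2) * P) by reflexivity.
        replace ((v ^ 2 + r ^ 2) ^ S (S k)) with
          ((v ^ 2 + r ^ 2) * ((v ^ 2 + r ^ 2) * P)) by reflexivity.
        field; repeat split; lra. }
    apply is_derive_scal, (is_derive_plus (V := R_NormedModule)).
    2:{ apply is_derive_scal, HG. }
    apply (is_derive_mult (K := R_AbsRing) (fun v => v)
      (fun v => / (v ^ 2 + r ^ 2) ^ (S k))); [apply (is_derive_id (K := R_AbsRing))| |apply Rmult_comm].
    replace (- _) with (- (K * (2 * v) * (v ^ 2 + r ^ 2) ^ k) / ((v ^ 2 + r ^ 2) ^ (S k)) ^ 2)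
      by (unfold Rdiv; ring).
    apply is_derive_inv; [|apply Rgt_not_eq, pow_lt, HQ].
    apply (is_derive_pow (fun v => v ^ 2 + r ^ 2) (S k)).
    auto_derive; auto; ring.
  + intros v Hv; specialize (Hb v Hv); specialize (HQ v).
    assert (Hvk : v * / (v ^ 2 + r ^ 2) ^ (S k) <= / (r ^ 2) ^ k * / v).
    { replace (/ (r ^ 2) ^ k * / v) with (v * / (v ^ 2 * (r ^ 2) ^ k)) by (field; lra).
      apply Rmult_le_compat_l; [lra|].
      assert (0 < v ^ 2) by (apply pow_lt, Hv).
      apply Rinv_le_contravar; [apply Rmult_lt_0_compat; lra|].
      cbn [pow] in *; apply Rmult_le_compat; try lra.
      apply pow_incr; lra. }
    assert (Hd : 0 < / (2 * K * r ^ 2)).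
    { apply Rinv_0_lt_compat, Rmult_lt_0_compat; lra. }
    replace (_ - _) with (/ (2 * K * r ^ 2) *
      (v * / (v ^ 2 + r ^ 2) ^ S k + (2 * K - 1) * (G v - G 0))) by ring.
    replace (wallis_const (S k) / r ^ (2 * S k + 1) +
        / (2 * K * r ^ 2) * (/ (r ^ 2) ^ k + (2 * K - 1) * d) / v) with
      (/ (2 * K * r ^ 2) * (/ (r ^ 2) ^ k * / v +
        (2 * K - 1) * (wallis_const k / r ^ (2 * k + 1) + d / v))).
    2:{ cbn [wallis_const]; rewrite Hk.
        replace (r ^ (2 * S k + 1)) with (r ^ 2 * r ^ (2 * k + 1))
          by (rewrite <- pow_add; f_equal; lia).
        assert (0 < r ^ (2 * k + 1)) by (apply pow_lt, Hr).
        field; repeat split; lra. }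
    apply Rmult_le_compat_l; [lra|].
    assert ((2 * K - 1) * (G v - G 0) <= (2 * K - 1) * (wallis_const k / r ^ (2 * k + 1) + d / v))
      by (apply Rmult_le_compat_l; lra).
    lra.
Qed.

Definition sin_int (n : nat) : R := RInt (fun t => sin t ^ n) 0 (PI / 2).

Lemma ex_RInt_sin_pow n : ex_RInt (fun t => sin t ^ n) 0 (PI / 2).
Proof.
apply (ex_RInt_continuous (V := R_CompleteNormedModule)); intros t _.
apply (ex_derive_continuous (K := R_AbsRing) (V := R_NormedModule)).
auto_derive; auto.
Qed.

Lemma sin_int_rec n : INR (n + 2) * sin_int (n + 2) = INR (n + 1) * sin_int n.
Proof.
assert (H1 : is_RInt (fun t => INR (n + 2) * sin t ^ (n + 2) - INR (n + 1) * sin t ^ n)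
  0 (PI / 2) (INR (n + 2) * sin_int (n + 2) - INR (n + 1) * sin_int n)).
{ apply (is_RInt_minus (V := R_NormedModule));
    apply (is_RInt_scal (V := R_NormedModule)), (RInt_correct (V := R_CompleteNormedModule)),
      ex_RInt_sin_pow. }
assert (H2 : is_RInt (fun t => INR (n + 2) * sin t ^ (n + 2) - INR (n + 1) * sin t ^ n)
  0 (PI / 2) (minus (- cos (PI / 2) * sin (PI / 2) ^ (S n)) (- cos 0 * sin 0 ^ (S n)))).
{ apply (is_RInt_derive (V := R_CompleteNormedModule) (fun t => - cos t * sin t ^ (S n))).
  - intros t _.
    replace (_ - _) with (sin t * sin t ^ S n + - cos t * (INR (S n) * cos t * sin t ^ n)).
    2:{ replace (n + 2)%nat with (S (S n)) by lia; replace (n + 1)%nat with (S n) by lia.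
        rewrite (S_INR (S n)); cbn [pow].
        assert (E : cos t * cos t = 1 - sin t * sin t)
          by (generalize (sin2_cos2 t); unfold Rsqr; lra).
        replace (- cos t * (INR (S n) * cos t * sin t ^ n)) with
          (- (INR (S n) * (cos t * cos t) * sin t ^ n)) by ring.
        rewrite E; ring. }
    apply (is_derive_mult (K := R_AbsRing) (fun t => - cos t) (fun t => sin t ^ S n));
      [ | |apply Rmult_comm].
    + auto_derive; auto; ring.
    + apply (is_derive_pow sin (S n)), is_derive_sin.
  - intros t _.
    apply (ex_derive_continuous (K := R_AbsRing) (V := R_NormedModule)); auto_derive; auto. }
apply (is_RInt_unique (V := R_CompleteNormedModule)) in H1.
apply (is_RInt_unique (V := R_CompleteNormedModule)) in H2.
rewrite H1 in H2; unfold minus, plus, opp in H2; simpl in H2.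
rewrite cos_PI2, sin_0 in H2; lra.
Qed.

Lemma sin_int_0 : sin_int 0 = PI / 2.
Proof.
unfold sin_int; simpl; rewrite RInt_const; unfold scal; simpl; unfold mult; simpl; field.
Qed.

Lemma sin_int_1 : sin_int 1 = 1.
Proof.
apply is_RInt_unique.
replace 1 with (minus (- cos (PI / 2)) (- cos 0))
  by (unfold minus, plus, opp; simpl; rewrite cos_PI2, cos_0; ring).
apply (is_RInt_derive (V := R_CompleteNormedModule) (fun t => - cos t)).
- intros t _; auto_derive; auto; ring.
- intros t _; apply (ex_derive_continuous (K := R_AbsRing) (V := R_NormedModule)).
  auto_derive; auto.
Qed.

Lemma sin_int_decr n : sin_int (S n) <= sin_int n.
Proof.
apply RInt_le; try apply ex_RInt_sin_pow; [generalize PI_RGT_0; lra|].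
intros t Ht; assert (0 <= sin t) by (apply sin_ge_0; generalize PI_RGT_0; lra).
assert (sin t <= 1) by apply SIN_bound.
assert (0 <= sin t ^ n) by (apply pow_le; assumption).
simpl; nra.
Qed.

(** [n! / ((1/2) (3/2) ... (n - 1/2))], the Wallis product. *)
Fixpoint wallis_prod (n : nat) : R :=
  match n with
  | O => 1
  | S m => wallis_prod m * ((INR m + 1) / (INR m + 1 / 2))
  end.

Lemma wallis_prod_pos n : 0 < wallis_prod n.
Proof.
induction n as [|n IH]; simpl; [lra|]; generalize (pos_INR n); intros.
apply Rmult_lt_0_compat; auto; apply Rdiv_lt_0_compat; lra.
Qed.

Lemma sin_int_even n : sin_int (2 * n) = PI / 2 / wallis_prod n.
Proof.
induction n as [|n IH]; [change (2 * 0)%nat with 0%nat; rewrite sin_int_0; simpl; field|].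
generalize (sin_int_rec (2 * n)); rewrite IH.
replace (2 * S n)%nat with (2 * n + 2)%nat by lia.
rewrite !plus_INR, mult_INR; change (INR 2) with 2; change (INR 1) with 1; intros E.
generalize (pos_INR n) (wallis_prod_pos n); intros.
apply Rmult_eq_reg_l with (2 * INR n + 2); [|lra].
rewrite E; cbn [wallis_prod]; field; repeat split; lra.
Qed.

Lemma sin_int_odd n : sin_int (2 * n + 1) = wallis_prod n / (2 * INR n + 1).
Proof.
induction n as [|n IH]; [change (2 * 0 + 1)%nat with 1%nat; rewrite sin_int_1; simpl; field|].
generalize (sin_int_rec (2 * n + 1)); rewrite IH.
replace (2 * S n + 1)%nat with (2 * n + 1 + 2)%nat by lia.
rewrite !plus_INR, mult_INR; change (INR 2) with 2; change (INR 1) with 1; intros E.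
generalize (pos_INR n) (wallis_prod_pos n); intros.
apply Rmult_eq_reg_l with (2 * INR n + 1 + 2); [|lra].
rewrite E; cbn [wallis_prod]; rewrite S_INR; field; repeat split; lra.
Qed.

Lemma wallis_limit : is_lim_seq (fun n => wallis_prod n / sqrt (INR n)) (sqrt PI).
Proof.
generalize PI_RGT_0; intros HPI.
apply is_lim_seq_ext_loc with (fun n => sqrt (wallis_prod n * wallis_prod n / INR n)).
{ exists 1%nat; intros n Hn.
  assert (0 < INR n) by (apply lt_0_INR; lia).
  rewrite sqrt_div_alt, sqrt_square by (auto; generalize (wallis_prod_pos n); lra); auto. }
apply (is_lim_seq_cont sqrt); [apply continuous_sqrt|].
apply is_lim_seq_le_le_loc with (fun _ => PI) (fun n => PI + PI / 2 * / INR n).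
- exists 1%nat; intros n Hn.
  assert (HN : 1 <= INR n) by (apply (le_INR 1); lia).
  assert (Hq := wallis_prod_pos n).
  assert (D1 := sin_int_decr (2 * n)); assert (D2 := sin_int_decr (2 * n + 1)).
  replace (S (2 * n)) with (2 * n + 1)%nat in D1 by lia.
  replace (S (2 * n + 1)) with (2 * S n)%nat in D2 by lia.
  rewrite sin_int_even, sin_int_odd in D1, D2.
  assert (E1 : wallis_prod n * wallis_prod n <= PI / 2 * (2 * INR n + 1)).
  { apply Rmult_le_reg_r with (/ (wallis_prod n * (2 * INR n + 1))).
    - apply Rinv_0_lt_compat, Rmult_lt_0_compat; lra.
    - replace (_ * / _) with (wallis_prod n / (2 * INR n + 1)) by (field; lra).
      replace (PI / 2 * _ * _) with (PI / 2 / wallis_prod n) by (field; lra).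
      exact D1. }
  assert (E2 : PI * INR n <= wallis_prod n * wallis_prod n).
  { apply Rle_trans with (PI / 2 * ((2 * INR n + 1) * (2 * INR n + 1) / (2 * INR n + 2))).
    - replace (PI * INR n) with (PI / 2 * (2 * INR n)) by field.
      apply Rmult_le_compat_l; [lra|].
      apply Rmult_le_reg_r with (2 * INR n + 2); [lra|].
      replace (_ / (2 * INR n + 2) * (2 * INR n + 2)) with
        ((2 * INR n + 1) * (2 * INR n + 1)) by (field; lra).
      nra.
    - cbn [wallis_prod] in D2.
      replace (wallis_prod n * wallis_prod n) with
        (wallis_prod n / (2 * INR n + 1) * (wallis_prod n * (2 * INR n + 1))) by (field; lra).
      replace (PI / 2 * _) with
        (PI / 2 / (wallis_prod n * ((INR n + 1) / (INR n + 1 / 2))) *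
         (wallis_prod n * (2 * INR n + 1))) by (field; repeat split; lra).
      apply Rmult_le_compat_r; [|exact D2].
      apply Rmult_le_pos; lra. }
  split.
  + apply Rmult_le_reg_r with (INR n); [lra|].
    replace (wallis_prod n * wallis_prod n / INR n * INR n) with
      (wallis_prod n * wallis_prod n) by (field; lra); exact E2.
  + apply Rmult_le_reg_r with (INR n); [lra|].
    replace (wallis_prod n * wallis_prod n / INR n * INR n) with
      (wallis_prod n * wallis_prod n) by (field; lra).
    replace (_ * INR n) with (PI / 2 * (2 * INR n + 1)) by (field; lra); exact E1.
- apply is_lim_seq_const.
- replace (Finite PI) with (Finite (PI + PI / 2 * 0)) by (f_equal; ring).
  apply is_lim_seq_plus'; [apply is_lim_seq_const|].
  apply is_lim_seq_mult'; [apply is_lim_seq_const | apply is_lim_seq_inv_INR].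
Qed.

Lemma wallis_prod_fact n :
  wallis_prod n = 4 ^ n * (INR (fact n) * INR (fact n)) / INR (fact (2 * n)).
Proof.
induction n as [|n IH]; [simpl; field|].
replace (2 * S n)%nat with (S (S (2 * n))) by lia.
rewrite !fact_simpl, !mult_INR, !S_INR, mult_INR; change (INR 2) with 2.
cbn [wallis_prod]; rewrite IH; cbn [pow].
generalize (pos_INR n); intros; field.
repeat split; try apply INR_fact_neq_0; lra.
Qed.

(** * Euler's integral and Gauss's product *)

(** ** Absolutely convergent improper integrals *)

(** The Cauchy criterion passes from [Dom] to [Phi], one component at a time. *)
Lemma dominated_limit (F : (R -> Prop) -> Prop) (FF : ProperFilter F)
    (Phi : R -> C) (Dom : R -> R) (d : R) :
  F (fun t => 0 < t) ->
  (forall a b, 0 < a -> 0 < b -> Cmod (Phi b - Phi a) <= Rabs (Dom b - Dom a)) ->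
  filterlim Dom F (locally d) ->
  exists l : C, forall eps, 0 < eps -> F (fun t => 0 < t /\ Cmod (Phi t - l) < eps).
Proof.
intros F0 Hle Hd.
assert (HC : forall g : C -> R, (forall z, Rabs (g z) <= Cmod z) ->
    (forall z w, g (z - w)%C = g z - g w) ->
    exists y, filterlim (fun t => g (Phi t)) F (locally y)).
{ intros g Hg1 Hg2.
  apply (filterlim_locally_cauchy (U := R_CompleteSpace) (fun t => g (Phi t))).
  intros eps.
  assert (He : 0 < eps / 2) by (generalize (cond_pos eps); lra).
  exists (fun t => 0 < t /\ Rabs (Dom t - d) < eps / 2); split.
  - apply filter_and; auto.
    apply (Hd (fun y => Rabs (y - d) < eps / 2)).
    exists (mkposreal _ He); intros y Hy; exact Hy.
  - intros u v [Hu1 Hu2] [Hv1 Hv2].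
    change (Rabs (g (Phi v) - g (Phi u)) < eps); rewrite <- Hg2.
    eapply Rle_lt_trans; [apply Hg1|].
    eapply Rle_lt_trans; [apply Hle; assumption|].
    revert Hu2 Hv2; unfold Rabs; repeat destruct Rcase_abs; lra. }
destruct (HC Re re_le_Cmod (fun _ _ => eq_refl)) as [a Ha].
destruct (HC Im im_le_Cmod (fun _ _ => eq_refl)) as [b Hb].
exists (a, b); intros eps Heps.
assert (He : 0 < eps / 2) by lra.
assert (Ha' : F (fun t => Rabs (Re (Phi t) - a) < eps / 2)).
{ apply (Ha (fun y => Rabs (y - a) < eps / 2)).
  exists (mkposreal _ He); intros y Hy; exact Hy. }
assert (Hb' : F (fun t => Rabs (Im (Phi t) - b) < eps / 2)).
{ apply (Hb (fun y => Rabs (y - b) < eps / 2)).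
  exists (mkposreal _ He); intros y Hy; exact Hy. }
generalize (filter_and _ _ F0 (filter_and _ _ Ha' Hb')).
apply filter_imp; intros t [Ht [H1 H2]]; split; auto.
eapply Rle_lt_trans; [apply Cmod_le_Re_Im|].
rewrite Re_minus, Im_minus; simpl; lra.
Qed.

Lemma Cderiv_is_RInt (f Phi : R -> C) a b : 0 < a -> 0 < b ->
  (forall t, 0 < t -> Cderiv Phi t (f t)) ->
  (forall t, 0 < t -> continuous (fun s => Re (f s)) t /\ continuous (fun s => Im (f s)) t) ->
  is_RInt (V := C_R_NormedModule) f a b (Phi b - Phi a)%C.
Proof.
intros Ha Hb HD HC.
assert (Hpos : forall t, Rmin a b <= t -> 0 < t).
{ intros t; unfold Rmin; destruct Rle_dec; lra. }
apply (is_RInt_fct_extend_pair (U := R_NormedModule) (V := R_NormedModule) f a b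
  (Re (Phi b) - Re (Phi a)) (Im (Phi b) - Im (Phi a))).
- apply (is_RInt_derive (V := R_CompleteNormedModule) (fun t => Re (Phi t)) (fun t => Re (f t)));
    intros t [Ht _]; [apply HD | apply HC]; auto.
- apply (is_RInt_derive (V := R_CompleteNormedModule) (fun t => Im (Phi t)) (fun t => Im (f t)));
    intros t [Ht _]; [apply HD | apply HC]; auto.
Qed.

Lemma dominated_improper_integral (f Phi : R -> C) (Dom dom : R -> R) d0 d1 :
  (forall t, 0 < t -> Cderiv Phi t (f t)) ->
  (forall t, 0 < t -> continuous (fun s => Re (f s)) t /\ continuous (fun s => Im (f s)) t) ->
  (forall t, 0 < t -> is_derive Dom t (dom t)) ->
  (forall t, 0 < t -> Cmod (f t) <= dom t) ->
  filterlim Dom (at_right 0) (locally d0) ->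
  filterlim Dom (Rbar_locally p_infty) (locally d1) ->
  exists E : C,
    is_RInt_gen (V := C_R_CompleteNormedModule) f (at_right 0) (Rbar_locally p_infty) E /\
    forall eps, 0 < eps -> exists d B, 0 < d /\
      forall a b, 0 < a < d -> B < b -> Cmod (Phi b - Phi a - E) < eps.
Proof.
intros HD HC HDom Hle H0 H1.
assert (Hmv : forall a b, 0 < a -> 0 < b -> Cmod (Phi b - Phi a) <= Rabs (Dom b - Dom a)).
{ assert (W : forall a b, 0 < a -> a <= b -> Cmod (Phi b - Phi a) <= Rabs (Dom b - Dom a)).
  { intros a b Ha Hab; eapply Rle_trans; [|apply Rle_abs].
    apply (Cmean_value_le Phi f Dom dom); auto; intros t Ht;
      [apply HD | apply HDom | apply Hle]; lra. }
  intros a b Ha Hb; destruct (Rle_dec a b); [apply W; lra|].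
  rewrite Rabs_minus_sym, <- Cmod_opp.
  replace (- (Phi b - Phi a))%C with (Phi a - Phi b)%C by ring; apply W; lra. }
destruct (dominated_limit (at_right 0) _ Phi Dom d0) as [l0 Hl0]; auto.
{ exists (mkposreal 1 Rlt_0_1); auto. }
destruct (dominated_limit (Rbar_locally p_infty) _ Phi Dom d1) as [l1 Hl1]; auto.
{ exists 0; auto. }
exists (l1 - l0)%C.
assert (HE : forall a b eps, Cmod (Phi a - l0) < eps / 2 -> Cmod (Phi b - l1) < eps / 2 ->
  Cmod (Phi b - Phi a - (l1 - l0)) < eps).
{ intros a b eps Ha Hb.
  replace (Phi b - Phi a - (l1 - l0))%C with ((Phi b - l1) - (Phi a - l0))%C by ring.
  eapply Rle_lt_trans; [apply Cmod_triangle_minus | lra]. }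
split.
- intros P [eps HP].
  assert (He : 0 < eps / 2) by (generalize (cond_pos eps); lra).
  apply (Filter_prod _ _ _ _ _ (Hl0 _ He) (Hl1 _ He)).
  intros a b [Ha1 Ha2] [Hb1 Hb2].
  exists (Phi b - Phi a)%C; split.
  + apply (Cderiv_is_RInt f Phi); auto.
  + apply HP; specialize (HE a b eps Ha2 Hb2).
    split.
    * change (Rabs (Re (Phi b - Phi a - (l1 - l0))%C) < eps).
      eapply Rle_lt_trans; [apply re_le_Cmod | exact HE].
    * change (Rabs (Im (Phi b - Phi a - (l1 - l0))%C) < eps).
      eapply Rle_lt_trans; [apply im_le_Cmod | exact HE].
- intros eps Heps.
  destruct (Hl0 (eps / 2)) as [d Hd]; [lra|].
  destruct (Hl1 (eps / 2)) as [B HB]; [lra|].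
  exists d, B; split; [apply cond_pos|].
  intros a b Ha Hb; apply HE.
  + apply Hd; [|lra].
    change (Rabs (a - 0) < d); rewrite Rabs_pos_eq; lra.
  + apply HB, Hb.
Qed.

(** ** Domination of Euler's integrand *)

Lemma ln_le_minus_1 x : 0 < x -> ln x <= x - 1.
Proof.
intros Hx; generalize (exp_ineq1_le (ln x)); rewrite exp_ln by exact Hx; lra.
Qed.

Lemma Rpower_pos t p : 0 < Rpower t p.
Proof. apply exp_pos. Qed.

Lemma exp_le_compat x y : x <= y -> exp x <= exp y.
Proof. intros [H | ->]; [left; apply exp_increasing, H | right; reflexivity]. Qed.

Lemma Rpower_exp_bounded p : 0 < p ->
  exists K, forall t, 0 < t -> Rpower t p * exp (- t) <= K.
Proof.
intros Hp; exists (exp (p * ln p - p)); intros t Ht.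
unfold Rpower; rewrite <- exp_plus; apply exp_le_compat.
assert (H := ln_le_minus_1 (t / p) (Rdiv_lt_0_compat _ _ Ht Hp)).
rewrite ln_div in H by assumption.
assert (p * (ln t - ln p) <= p * (t / p - 1)) by (apply Rmult_le_compat_l; lra).
replace (p * (t / p - 1)) with (t - p) in * by (field; lra); lra.
Qed.

(** [t^(x-1) / (1 + t^x)^2], integrable on the half-line with the elementary primitive
    [- 1 / (x (1 + t^x))]; it serves as the dominating function both at 0 and at
    infinity. *)
Definition dom (x t : R) : R := Rpower t (x - 1) / (1 + Rpower t x) ^ 2.
Definition dom_prim (x t : R) : R := - / (x * (1 + Rpower t x)).

Lemma is_derive_Rpower p t : 0 < t ->
  is_derive (fun s => Rpower s p) t (p * Rpower t (p - 1)).
Proof.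
intros Ht; unfold Rpower; auto_derive; auto.
replace ((p - 1) * ln t) with (p * ln t + - ln t) by ring.
rewrite exp_plus, exp_Ropp, exp_ln by exact Ht; ring.
Qed.

Lemma is_derive_dom_prim x t : 0 < x -> 0 < t -> is_derive (dom_prim x) t (dom x t).
Proof.
intros Hx Ht; unfold dom_prim, dom.
assert (HP := Rpower_pos t x).
assert (D := is_derive_Rpower x t Ht).
assert (D1 : ex_derive (fun s => Rpower s x) t) by (eexists; exact D).
apply is_derive_unique in D.
set (g := fun s => Rpower s x) in *.
assert (E : Derive (fun s => g s) t = x * Rpower t (x - 1)) by exact D.
change (Rpower t x) with (g t) in *.
apply (is_derive_ext (fun s => - / (x * (1 + g s)))); [reflexivity|].
auto_derive; [repeat split; auto; apply Rgt_not_eq, Rmult_lt_0_compat; lra|].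
rewrite E; field; split; lra.
Qed.

Lemma dom_prim_bounds x t : 0 < x -> - / x <= dom_prim x t <= 0.
Proof.
intros Hx; unfold dom_prim; assert (HP := Rpower_pos t x).
assert (0 < x * (1 + Rpower t x)) by (apply Rmult_lt_0_compat; lra).
split.
- apply Ropp_le_contravar, Rinv_le_contravar; nra.
- assert (0 < / (x * (1 + Rpower t x))) by (apply Rinv_0_lt_compat; assumption); lra.
Qed.

Lemma Rpower_lt_of_lt x y t : 0 < x -> 0 < y -> 0 < t < Rpower y (/ x) -> Rpower t x < y.
Proof.
intros Hx Hy [Ht Hty].
replace y with (Rpower (Rpower y (/ x)) x).
- apply Rlt_Rpower_l; lra.
- rewrite Rpower_mult, Rinv_l, Rpower_1; lra.
Qed.

Lemma Rpower_gt_of_gt x y t : 0 < x -> 0 < y -> Rpower y (/ x) < t -> y < Rpower t x.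
Proof.
intros Hx Hy Hty.
replace y with (Rpower (Rpower y (/ x)) x).
- apply Rlt_Rpower_l; auto; split; auto; apply Rpower_pos.
- rewrite Rpower_mult, Rinv_l, Rpower_1; lra.
Qed.

Lemma dom_prim_at_0 x : 0 < x -> filterlim (dom_prim x) (at_right 0) (locally (- / x)).
Proof.
intros Hx P [eps HP].
assert (He : 0 < x * eps) by (apply Rmult_lt_0_compat; auto; apply cond_pos).
exists (mkposreal _ (Rpower_pos (x * eps) (/ x))).
intros t Ht Ht0; apply HP.
change (Rabs (t - 0) < Rpower (x * eps) (/ x)) in Ht.
rewrite Rminus_0_r, Rabs_pos_eq in Ht by lra.
change (Rabs (dom_prim x t - - / x) < eps).
assert (HP1 := Rpower_pos t x).
assert (HP2 := Rpower_lt_of_lt x _ t Hx He (conj Ht0 Ht)).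
rewrite Rabs_pos_eq by (generalize (dom_prim_bounds x t Hx); lra).
unfold dom_prim.
replace (- / (x * (1 + Rpower t x)) - - / x) with (Rpower t x / (x * (1 + Rpower t x)))
  by (field; lra).
apply Rmult_lt_reg_r with (x * (1 + Rpower t x)); [nra|].
unfold Rdiv; rewrite Rmult_assoc, Rinv_l by nra.
generalize (cond_pos eps); intros; nra.
Qed.

Lemma dom_prim_at_infty x : 0 < x ->
  filterlim (dom_prim x) (Rbar_locally p_infty) (locally 0).
Proof.
intros Hx P [eps HP].
assert (He : 0 < / (x * eps))
  by (apply Rinv_0_lt_compat, Rmult_lt_0_compat; auto; apply cond_pos).
exists (Rpower (/ (x * eps)) (/ x)); intros t Ht; apply HP.
change (Rabs (dom_prim x t - 0) < eps).
assert (HP2 := Rpower_gt_of_gt x _ t Hx He Ht).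
assert (HP1 := Rpower_pos t x).
rewrite Rminus_0_r, Rabs_left1 by (generalize (dom_prim_bounds x t Hx); lra).
unfold dom_prim; rewrite Ropp_involutive.
assert (Hc := cond_pos eps).
assert (1 < x * eps * Rpower t x).
{ apply Rmult_lt_compat_l with (r := x * eps) in HP2; [|nra].
  rewrite Rinv_r in HP2; nra. }
apply Rmult_lt_reg_r with (x * (1 + Rpower t x)); [nra|].
rewrite Rinv_l by nra; nra.
Qed.

(** The factor [1 + t^2] leaves room for the error [t^2 e^(-t) / n] made by
    replacing [e^(-t)] with [(1 - t/n)^n]. *)
Lemma euler_dominated x : 0 < x -> exists K, 0 < K /\ forall t, 0 < t ->
  Rpower t (x - 1) * ((1 + t ^ 2) * exp (- t)) <= K * dom x t.
Proof.
intros Hx.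
destruct (Rpower_exp_bounded 2) as [K1 H1]; [lra|].
destruct (Rpower_exp_bounded (x + x)) as [K2 H2]; [lra|].
destruct (Rpower_exp_bounded (x + x + 2)) as [K3 H3]; [lra|].
assert (P1 : 0 < K1).
{ eapply Rlt_le_trans; [|apply (H1 1); lra]; apply Rmult_lt_0_compat; apply exp_pos. }
assert (P2 : 0 < K2).
{ eapply Rlt_le_trans; [|apply (H2 1); lra]; apply Rmult_lt_0_compat; apply exp_pos. }
assert (P3 : 0 < K3).
{ eapply Rlt_le_trans; [|apply (H3 1); lra]; apply Rmult_lt_0_compat; apply exp_pos. }
exists (2 * (1 + K1 + K2 + K3)); split; [lra|].
intros t Ht; specialize (H1 t Ht); specialize (H2 t Ht); specialize (H3 t Ht).
assert (He : exp (- t) <= 1) by (rewrite <- exp_0; apply exp_le_compat; lra).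
assert (He0 := exp_pos (- t)).
replace (Rpower t 2) with (t ^ 2) in H1 by (rewrite <- Rpower_pow by exact Ht; reflexivity).
rewrite !Rpower_plus in H2, H3.
replace (Rpower t 2) with (t ^ 2) in H3 by (rewrite <- Rpower_pow by exact Ht; reflexivity).
rewrite Rpower_plus in H3.
unfold dom.
assert (HP := Rpower_pos t x); assert (HQ := Rpower_pos t (x - 1)).
set (p := Rpower t x) in *.
apply Rmult_le_reg_r with ((1 + p) ^ 2); [apply pow_lt; lra|].
replace (2 * (1 + K1 + K2 + K3) * (Rpower t (x - 1) / (1 + p) ^ 2) * (1 + p) ^ 2) with
  (Rpower t (x - 1) * (2 * (1 + K1 + K2 + K3))) by (field; lra).
rewrite Rmult_assoc; apply Rmult_le_compat_l; [lra|].
assert (Hp2 : (1 + p) ^ 2 <= 2 * (1 + p * p)) by (generalize (Rle_0_sqr (p - 1)); unfold Rsqr; simpl; lra).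
apply Rle_trans with ((1 + t ^ 2) * exp (- t) * (2 * (1 + p * p))).
- apply Rmult_le_compat_l; auto; apply Rmult_le_pos; [nra | lra].
- lra.
Qed.

(** ** Complex powers of a positive real *)

Definition tpow (p : C) (t : R) : C := Cexp (p * RtoC (ln t)).

Lemma Cmod_tpow p t : Cmod (tpow p t) = Rpower t (Re p).
Proof.
unfold tpow; rewrite Cmod_Cexp; unfold Rpower; f_equal; destruct p; simpl; ring.
Qed.

Lemma tpow_plus_1 p t : 0 < t -> tpow (p + 1) t = (RtoC t * tpow p t)%C.
Proof.
intros Ht; unfold tpow.
replace ((p + 1) * RtoC (ln t))%C with (RtoC (ln t) + p * RtoC (ln t))%C by ring.
rewrite Cexp_plus, Cexp_RtoC, exp_ln by exact Ht; reflexivity.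
Qed.

Lemma Cderiv_tpow p t : 0 < t -> Cderiv (tpow p) t (p * tpow (p - 1) t)%C.
Proof.
intros Ht.
eapply Cderiv_eq.
- apply (Cderiv_Cexp (fun s => p * RtoC (ln s))%C t (0 * RtoC (ln t) + p * RtoC (/ t))%C).
  apply (Cderiv_mult (fun _ => p) (fun s => RtoC (ln s))); [apply Cderiv_const|].
  apply Cderiv_RtoC; auto_derive; auto; ring.
- fold (tpow p t).
  assert (E : tpow p t = (RtoC t * tpow (p - 1) t)%C)
    by (rewrite <- tpow_plus_1 by exact Ht; f_equal; ring).
  rewrite E, RtoC_inv by lra.
  field; apply RtoC_neq_0; lra.
Qed.

Definition euler_integrand (z : C) (t : R) : C := (tpow (z - 1) t * RtoC (exp (- t)))%C.

Lemma euler_integrand_cont z t : 0 < t ->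
  continuous (fun s => Re (euler_integrand z s)) t /\
  continuous (fun s => Im (euler_integrand z s)) t.
Proof.
intros Ht.
eapply Cderiv_cont, (Cderiv_mult (tpow (z - 1)) (fun s => RtoC (exp (- s)))).
- apply Cderiv_tpow, Ht.
- apply Cderiv_RtoC; auto_derive; auto.
Qed.

Definition euler_prim (z : C) (t : R) : C :=
  (RInt (fun s => Re (euler_integrand z s)) 1 t, RInt (fun s => Im (euler_integrand z s)) 1 t).

Lemma is_derive_RInt_half_line (g : R -> R) t : 0 < t ->
  (forall s, 0 < s -> continuous g s) -> is_derive (fun b => RInt g 1 b) t (g t).
Proof.
intros Ht Hg; apply (is_derive_RInt (V := R_NormedModule)) with 1; [|apply Hg, Ht].
exists (mkposreal _ Ht); intros b Hb.
change (Rabs (b - t) < t) in Hb.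
assert (Hb0 : 0 < b) by (revert Hb; unfold Rabs; destruct Rcase_abs; lra).
apply (RInt_correct (V := R_CompleteNormedModule)).
apply (ex_RInt_continuous (V := R_CompleteNormedModule)).
intros s Hs; apply Hg; revert Hs; unfold Rmin; destruct Rle_dec; lra.
Qed.

Lemma Cderiv_euler_prim z t : 0 < t -> Cderiv (euler_prim z) t (euler_integrand z t).
Proof.
intros Ht; split.
- apply (is_derive_RInt_half_line (fun s => Re (euler_integrand z s)) t Ht).
  intros s Hs; exact (proj1 (euler_integrand_cont z s Hs)).
- apply (is_derive_RInt_half_line (fun s => Im (euler_integrand z s)) t Ht).
  intros s Hs; exact (proj2 (euler_integrand_cont z s Hs)).
Qed.

Lemma Cmod_euler_integrand z t : Cmod (euler_integrand z t) = Rpower t (Re z - 1) * exp (- t).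
Proof.
unfold euler_integrand; rewrite Cmod_mult, Cmod_R, Cmod_tpow, Rabs_pos_eq
  by (left; apply exp_pos); reflexivity.
Qed.

Lemma Gamma_Euler z : 0 < Re z -> Gamma z = Euler_integral z.
Proof.
intros Hz; unfold Gamma.
assert (E : Z.to_nat (up (- Re z)) = 0%nat).
{ destruct (archimed (- Re z)) as [_ H].
  assert (H1 : IZR (up (- Re z)) < 1) by lra.
  apply lt_IZR in H1; lia. }
rewrite E; cbn [rising]; simpl (INR 0).
replace (z + RtoC 0)%C with z by ring; field.
Qed.

Lemma euler_prim_limit z : 0 < Re z ->
  forall eps, 0 < eps -> exists d B, 0 < d /\
    forall a b, 0 < a < d -> B < b ->
      Cmod (euler_prim z b - euler_prim z a - Gamma z) < eps.
Proof.
intros Hz; destruct (euler_dominated (Re z) Hz) as [K [HK HKt]].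
destruct (dominated_improper_integral (euler_integrand z) (euler_prim z)
  (fun t => K * dom_prim (Re z) t) (fun t => K * dom (Re z) t) (K * - / Re z) (K * 0))
  as [E [HE1 HE2]].
- intros t Ht; apply Cderiv_euler_prim, Ht.
- intros t Ht; apply euler_integrand_cont, Ht.
- intros t Ht; apply is_derive_scal, is_derive_dom_prim; assumption.
- intros t Ht; rewrite Cmod_euler_integrand.
  eapply Rle_trans; [|apply HKt, Ht].
  apply Rmult_le_compat_l; [left; apply Rpower_pos|].
  generalize (exp_pos (- t)); intros; assert (0 <= t ^ 2) by nra; nra.
- apply (filterlim_comp _ _ _ (dom_prim (Re z)) (fun y => K * y) _ (locally (- / Re z)));
    [apply dom_prim_at_0, Hz|].
  apply (filterlim_scal_r (K := R_AbsRing) (V := R_NormedModule) K).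
- apply (filterlim_comp _ _ _ (dom_prim (Re z)) (fun y => K * y) _ (locally 0));
    [apply dom_prim_at_infty, Hz|].
  apply (filterlim_scal_r (K := R_AbsRing) (V := R_NormedModule) K).
- replace (Gamma z) with E; [exact HE2|].
  rewrite Gamma_Euler by exact Hz; symmetry.
  change (Euler_integral z) with (RInt_gen (V := C_R_CompleteNormedModule)
    (euler_integrand z) (at_right 0) (Rbar_locally p_infty)).
  apply (is_RInt_gen_unique (V := C_R_CompleteNormedModule) (euler_integrand z) E).
  exact HE1.
Qed.

(** ** Gauss's product *)

Lemma exp_pow_n x n : exp x ^ n = exp (INR n * x).
Proof.
induction n as [|n IH]; [simpl; rewrite Rmult_0_l, exp_0; reflexivity|].
rewrite S_INR; cbn [pow]; rewrite IH, <- exp_plus; f_equal; ring.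
Qed.

Lemma bernoulli_ineq u n : 0 <= u <= 1 -> 1 - INR n * u <= (1 - u) ^ n.
Proof.
intros Hu; induction n as [|n IH]; [simpl; lra|].
rewrite S_INR; cbn [pow].
assert (0 <= INR n) by apply pos_INR.
assert ((1 - u) * (1 - INR n * u) <= (1 - u) * (1 - u) ^ n) by (apply Rmult_le_compat_l; lra).
assert (0 <= INR n * (u * u)) by (apply Rmult_le_pos; nra).
nra.
Qed.

(** From [1 - u <= e^(-u)] and [(1 - u) e^u >= 1 - u^2], with [u = t / n]. *)
Lemma exp_approx t n : (1 <= n)%nat -> 0 <= t <= INR n ->
  0 <= exp (- t) - (1 - t / INR n) ^ n <= t ^ 2 * exp (- t) / INR n.
Proof.
intros Hn Ht.
assert (HN : 1 <= INR n) by (apply (le_INR 1); exact Hn).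
set (u := t / INR n).
assert (Eu : INR n * u = t) by (unfold u; field; lra).
assert (Hu : 0 <= u <= 1) by nra.
assert (E1 : exp (- t) = exp (- u) ^ n) by (rewrite exp_pow_n; f_equal; lra).
split.
- assert ((1 - u) ^ n <= exp (- u) ^ n); [|lra].
  apply pow_incr; split; [lra|].
  generalize (exp_ineq1_le (- u)); lra.
- assert (A1 : 1 - u * u <= (1 - u) * exp u).
  { generalize (exp_ineq1_le u); intros; nra. }
  assert (A2 : 1 - INR n * (u * u) <= ((1 - u) * exp u) ^ n).
  { eapply Rle_trans; [apply bernoulli_ineq; nra|].
    apply pow_incr; split; [nra | exact A1]. }
  rewrite Rpow_mult_distr, exp_pow_n, Eu in A2.
  assert (A3 : exp t * exp (- t) = 1) by (rewrite <- exp_plus, Rplus_opp_r; apply exp_0).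
  assert (A4 : exp (- t) * (1 - INR n * (u * u)) <= exp (- t) * ((1 - u) ^ n * exp t))
    by (apply Rmult_le_compat_l; [left; apply exp_pos | exact A2]).
  replace (exp (- t) * ((1 - u) ^ n * exp t)) with ((1 - u) ^ n * (exp t * exp (- t))) in A4 by ring.
  rewrite A3 in A4.
  replace (t ^ 2 * exp (- t) / INR n) with (exp (- t) * (INR n * (u * u)))
    by (unfold u; field; lra).
  lra.
Qed.

(** A primitive of [t^(z-1) (1 - t/n)^k], obtained by peeling off one factor
    [1 - t/n] at a time. *)
Fixpoint gauss_prim (n : R) (k : nat) (z : C) (t : R) : C :=
  match k with
  | O => (tpow z t / z)%C
  | S m => (gauss_prim n m z t - RtoC (/ n) * gauss_prim n m (z + 1) t)%C
  end.

Lemma Cderiv_gauss_prim n k z t : 0 < t -> 0 < Re z ->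
  Cderiv (gauss_prim n k z) t (tpow (z - 1) t * RtoC ((1 - t / n) ^ k))%C.
Proof.
intros Ht; revert z; induction k as [|k IH]; intros z Hz.
- assert (Hn := Re_pos_neq_0 z Hz).
  eapply Cderiv_eq.
  + apply (Cderiv_mult (tpow z) (fun _ => / z)%C); [apply Cderiv_tpow, Ht | apply Cderiv_const].
  + simpl; field; exact Hn.
- eapply Cderiv_eq.
  + apply (Cderiv_minus (gauss_prim n k z) (fun s => RtoC (/ n) * gauss_prim n k (z + 1) s)%C);
      [apply IH, Hz|].
    apply (Cderiv_mult (fun _ => RtoC (/ n)) (gauss_prim n k (z + 1)));
      [apply Cderiv_const | apply IH; rewrite Re_plus; simpl; lra].
  + replace (z + 1 - 1)%C with (z - 1 + 1)%C by ring.
    rewrite tpow_plus_1 by exact Ht.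
    cbn [pow]; unfold Rdiv; rewrite RtoC_mult, RtoC_minus, RtoC_mult; ring.
Qed.

Lemma gauss_prim_bound n k z : 0 < n -> 0 < Re z -> exists K, 0 < K /\
  forall t, 0 < t <= 1 -> Cmod (gauss_prim n k z t) <= K * Rpower t (Re z).
Proof.
intros Hn; revert z; induction k as [|k IH]; intros z Hz.
- assert (H0 := Re_pos_neq_0 z Hz).
  assert (HM : 0 < Cmod z) by (apply Cmod_gt_0, H0).
  exists (/ Cmod z); split; [apply Rinv_0_lt_compat, HM|].
  intros t Ht; simpl; rewrite Cmod_div, Cmod_tpow by exact H0.
  unfold Rdiv; lra.
- destruct (IH z Hz) as [K1 [HK1 H1]].
  destruct (IH (z + 1)%C) as [K2 [HK2 H2]]; [rewrite Re_plus; simpl; lra|].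
  assert (Hi : 0 < / n) by (apply Rinv_0_lt_compat, Hn).
  exists (K1 + / n * K2); split; [nra|].
  intros t Ht; cbn [gauss_prim].
  eapply Rle_trans; [apply Cmod_triangle_minus|].
  rewrite Cmod_mult, Cmod_R, Rabs_pos_eq by lra.
  specialize (H1 t Ht); specialize (H2 t Ht).
  rewrite Re_plus in H2; change (Re (RtoC 1)) with 1 in H2.
  rewrite Rpower_plus, Rpower_1 in H2 by lra.
  assert (HP := Rpower_pos t (Re z)).
  assert (Cmod (gauss_prim n k (z + 1) t) <= K2 * Rpower t (Re z)).
  { eapply Rle_trans; [exact H2|].
    apply Rmult_le_compat_l; nra. }
  assert (/ n * Cmod (gauss_prim n k (z + 1) t) <= / n * (K2 * Rpower t (Re z)))
    by (apply Rmult_le_compat_l; lra).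
  lra.
Qed.

Lemma rising_neq_0 z n : 0 < Re z -> rising z n <> 0%C.
Proof.
intros Hz; induction n as [|n IH]; cbn [rising]; [apply RtoC_neq_0; lra|].
apply Cmult_neq_0; auto.
apply Re_pos_neq_0; rewrite Re_shift; generalize (pos_INR n); lra.
Qed.

Lemma rising_shift z n : rising z (S n) = (z * rising (z + 1) n)%C.
Proof.
induction n as [|n IH]; [simpl; ring|].
change (rising z (S (S n))) with (rising z (S n) * (z + RtoC (INR (S n))))%C.
rewrite IH, RtoC_INR_S; cbn [rising]; ring.
Qed.

Lemma gauss_prim_at_end n k z : 0 < n -> 0 < Re z ->
  gauss_prim n k z n = (tpow z n * RtoC (INR (fact k)) / rising z (S k))%C.
Proof.
intros Hn; revert z; induction k as [|k IH]; intros z Hz.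
- simpl; field; apply Re_pos_neq_0, Hz.
- cbn [gauss_prim]; rewrite !IH by (try rewrite Re_plus; simpl; lra).
  rewrite tpow_plus_1 by exact Hn.
  assert (H1 := rising_neq_0 z (S k) Hz).
  assert (H2 : (z + RtoC (INR (S k)))%C <> 0%C).
  { apply Re_pos_neq_0; rewrite Re_shift; generalize (pos_INR (S k)); lra. }
  assert (H3 : (z <> 0)%C) by (apply Re_pos_neq_0, Hz).
  assert (H4 : rising (z + 1) (S k) = (rising z (S k) * (z + RtoC (INR (S k))) / z)%C).
  { change (rising z (S k) * (z + RtoC (INR (S k))))%C with (rising z (S (S k))).
    rewrite (rising_shift z (S k)); field; exact H3. }
  rewrite H4.
  change (rising z (S (S k))) with (rising z (S k) * (z + RtoC (INR (S k))))%C.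
  rewrite fact_simpl, mult_INR, RtoC_mult, RtoC_inv by lra.
  field; repeat split; auto; apply RtoC_neq_0; lra.
Qed.

Definition gauss_prod (z : C) (n : nat) : C :=
  (tpow z (INR n) * RtoC (INR (fact n)) / rising z (S n))%C.

(** Gauss's product is the integral of [t^(z-1) (1 - t/n)^n] over [(0, n)], whose
    distance to Euler's integral is at most a constant over [n]. *)
Lemma Gamma_Gauss z : 0 < Re z -> Clim (gauss_prod z) (Gamma z).
Proof.
intros Hz; apply Clim_of_Cmod, is_lim_seq_spec; intros eps.
destruct (euler_dominated (Re z) Hz) as [K [HK HKt]].
assert (He : 0 < eps / 3) by (generalize (cond_pos eps); lra).
destruct (euler_prim_limit z Hz _ He) as [d [B [Hd HE]]].
assert (HL : is_lim_seq (fun n => K / Re z * / INR n) 0).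
{ replace (Finite 0) with (Finite (K / Re z * 0)) by (f_equal; ring).
  apply is_lim_seq_mult'; [apply is_lim_seq_const | apply is_lim_seq_inv_INR]. }
apply is_lim_seq_spec in HL; destruct (HL (mkposreal _ He)) as [N1 HN1].
generalize is_lim_seq_INR; intros HI; apply is_lim_seq_spec in HI.
destruct (HI B) as [N2 HN2].
exists (S (N1 + N2)); intros n Hn.
specialize (HN1 n ltac:(lia)); specialize (HN2 n ltac:(lia)); simpl in HN1.
assert (HN : 1 <= INR n) by (apply (le_INR 1); lia).
destruct (gauss_prim_bound (INR n) n z) as [L [HL0 HLt]]; [lra | exact Hz |].
set (y := eps / 3 / L).
assert (Hy : 0 < y) by (apply Rdiv_lt_0_compat; assumption).
set (a := Rmin (d / 2) (Rmin (1 / 2) (Rpower y (/ Re z) / 2))).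
assert (HRp := Rpower_pos y (/ Re z)).
assert (Ha : 0 < a /\ a < d /\ a < 1 /\ a < Rpower y (/ Re z)).
{ unfold a, Rmin; repeat destruct Rle_dec; repeat split; lra. }
destruct Ha as [Ha0 [Had [Ha1 Hay]]].
rewrite Rminus_0_r, Rabs_pos_eq by apply Cmod_ge_0.
unfold gauss_prod; rewrite <- gauss_prim_at_end by (lra || exact Hz).
set (Q := gauss_prim (INR n) n z) in *.
replace (Q (INR n) - Gamma z)%C with
  ((euler_prim z (INR n) - euler_prim z a - Gamma z)
   - ((euler_prim z (INR n) - Q (INR n)) - (euler_prim z a - Q a)) + Q a)%C by ring.
eapply Rle_lt_trans; [apply Cmod_triangle|].
eapply Rle_lt_trans; [apply Rplus_le_compat_r, Cmod_triangle_minus|].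
assert (B1 := HE a (INR n) (conj Ha0 Had) HN2).
assert (B3 : Cmod (Q a) < eps / 3).
{ eapply Rle_lt_trans; [apply HLt; lra|].
  assert (Rpower a (Re z) < y) by (apply Rpower_lt_of_lt; auto).
  replace (eps / 3) with (L * y) by (unfold y; field; lra).
  apply Rmult_lt_compat_l; assumption. }
assert (B2 : Cmod ((euler_prim z (INR n) - Q (INR n)) - (euler_prim z a - Q a)) <=
  K / INR n * dom_prim (Re z) (INR n) - K / INR n * dom_prim (Re z) a).
{ apply (Cmean_value_le (fun t => euler_prim z t - Q t)%C
    (fun t => euler_integrand z t - tpow (z - 1) t * RtoC ((1 - t / INR n) ^ n))%C
    (fun t => K / INR n * dom_prim (Re z) t) (fun t => K / INR n * dom (Re z) t)); [lra| | |].
  - intros t Ht; apply Cderiv_minus;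
      [apply Cderiv_euler_prim | apply Cderiv_gauss_prim]; lra.
  - intros t Ht; apply is_derive_scal, is_derive_dom_prim; lra.
  - intros t Ht; unfold euler_integrand.
    replace (_ - _)%C with (tpow (z - 1) t * RtoC (exp (- t) - (1 - t / INR n) ^ n))%C
      by (rewrite RtoC_minus; ring).
    rewrite Cmod_mult, Cmod_R, Cmod_tpow.
    destruct (exp_approx t n) as [X1 X2]; [lia | lra |].
    rewrite Rabs_pos_eq by exact X1.
    assert (Ht0 : 0 < t) by lra.
    specialize (HKt t Ht0).
    rewrite Re_minus; change (Re (RtoC 1)) with 1.
    assert (HP := Rpower_pos t (Re z - 1)).
    apply Rle_trans with (Rpower t (Re z - 1) * ((1 + t ^ 2) * exp (- t)) * / INR n).
    + rewrite Rmult_assoc; apply Rmult_le_compat_l; [lra|].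
      eapply Rle_trans; [exact X2|].
      apply Rmult_le_compat_r; [left; apply Rinv_0_lt_compat; lra|].
      generalize (exp_pos (- t)); intros; nra.
    + replace (K / INR n * dom (Re z) t) with (K * dom (Re z) t * / INR n) by (field; lra).
      apply Rmult_le_compat_r; [left; apply Rinv_0_lt_compat; lra | exact HKt]. }
assert (B4 : K / INR n * dom_prim (Re z) (INR n) - K / INR n * dom_prim (Re z) a <=
  K / Re z * / INR n).
{ assert (Hq : 0 <= K / INR n) by (left; apply Rdiv_lt_0_compat; lra).
  replace (K / Re z * / INR n) with (K / INR n * / Re z) by (field; lra).
  rewrite <- Rmult_minus_distr_l; apply Rmult_le_compat_l; auto.
  generalize (dom_prim_bounds (Re z) (INR n) Hz) (dom_prim_bounds (Re z) a Hz); lra. }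
rewrite Rminus_0_r in HN1.
generalize (Rle_abs (K / Re z * / INR n)); lra.
Qed.

(** * Special values of the Gamma function *)

Lemma Gamma_S z : 0 < Re z -> Gamma (z + 1) = (z * Gamma z)%C.
Proof.
intros Hz.
assert (Hz1 : 0 < Re (z + 1)%C) by (rewrite Re_plus; simpl; lra).
apply (Clim_unique (gauss_prod (z + 1))); [apply Gamma_Gauss, Hz1|].
apply Clim_ext_eventually with
  (fun n => z * (RtoC (INR n) / (z + RtoC (INR (S n)))) * gauss_prod z n)%C.
- exists 1%nat; intros n Hn.
  assert (HN : 0 < INR n) by (apply lt_0_INR; lia).
  unfold gauss_prod; rewrite tpow_plus_1 by exact HN.
  assert (H1 := rising_neq_0 z (S n) Hz).
  assert (H2 : (z + RtoC (INR (S n)))%C <> 0%C).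
  { apply Re_pos_neq_0; rewrite Re_shift; generalize (pos_INR (S n)); lra. }
  assert (H3 : (z <> 0)%C) by (apply Re_pos_neq_0, Hz).
  assert (H4 : rising (z + 1) (S n) = (rising z (S n) * (z + RtoC (INR (S n))) / z)%C).
  { change (rising z (S n) * (z + RtoC (INR (S n))))%C with (rising z (S (S n))).
    rewrite (rising_shift z (S n)); field; exact H3. }
  rewrite H4; field; auto.
- replace (z * Gamma z)%C with (z * 1 * Gamma z)%C by ring.
  apply Clim_mult; [|apply Gamma_Gauss, Hz].
  apply Clim_mult; [apply Clim_const|].
  apply (Clim_of_rate _ _ (Cmod (z + 1))); intros n Hn.
  assert (HN : 0 < INR n) by (apply lt_0_INR; lia).
  assert (H2 : (z + RtoC (INR (S n)))%C <> 0%C).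
  { apply Re_pos_neq_0; rewrite Re_shift; generalize (pos_INR (S n)); lra. }
  replace (RtoC (INR n) / (z + RtoC (INR (S n))) - 1)%C with
    (- (z + 1) / (z + RtoC (INR (S n))))%C by (rewrite RtoC_INR_S in *; field; exact H2).
  rewrite Cmod_div, Cmod_opp by exact H2.
  apply Rmult_le_compat_l; [apply Cmod_ge_0|].
  apply Rinv_le_contravar; [exact HN|].
  eapply Rle_trans; [|apply re_le_Cmod]; rewrite Re_shift, S_INR.
  rewrite Rabs_pos_eq; lra.
Qed.

Lemma GammaR_S x : 0 < x -> GammaR (x + 1) = x * GammaR x.
Proof.
intros Hx; unfold GammaR.
rewrite RtoC_plus, Gamma_S by exact Hx.
rewrite Re_mult; simpl; ring.
Qed.

Lemma GammaR_of_lim (x l : R) (u : nat -> R) : 0 < x ->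
  eventually (fun n => gauss_prod (RtoC x) n = RtoC (u n)) ->
  is_lim_seq u l -> GammaR x = l.
Proof.
intros Hx HE Hl; unfold GammaR.
rewrite (Clim_unique (gauss_prod (RtoC x)) (Gamma (RtoC x)) (RtoC l)); [reflexivity| |].
- apply Gamma_Gauss, Hx.
- apply Clim_ext_eventually with (fun n => RtoC (u n)); [|apply Clim_RtoC, Hl].
  revert HE; apply filter_imp; auto.
Qed.

Lemma lim_ratio_shift c : 0 <= c -> is_lim_seq (fun n => INR n / (INR n + c)) 1.
Proof.
intros Hc.
apply is_lim_seq_le_le_loc with (fun n => 1 - c * / INR n) (fun _ => 1).
- exists 1%nat; intros n Hn.
  assert (HN : 0 < INR n) by (apply lt_0_INR; lia).
  replace (INR n / (INR n + c)) with (1 - c * / (INR n + c)) by (field; lra).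
  assert (/ (INR n + c) <= / INR n) by (apply Rinv_le_contravar; lra).
  assert (0 < / (INR n + c)) by (apply Rinv_0_lt_compat; lra).
  split; nra.
- replace (Finite 1) with (Finite (1 - c * 0)) by (f_equal; ring).
  apply is_lim_seq_minus'; [apply is_lim_seq_const|].
  apply is_lim_seq_mult'; [apply is_lim_seq_const | apply is_lim_seq_inv_INR].
- apply is_lim_seq_const.
Qed.

Lemma tpow_RtoC p t : tpow (RtoC p) t = RtoC (Rpower t p).
Proof. unfold tpow; rewrite <- RtoC_mult, Cexp_RtoC; reflexivity. Qed.

Lemma rising_1 n : rising 1 n = RtoC (INR (fact n)).
Proof.
induction n as [|n IH]; [reflexivity|].
cbn [rising]; rewrite IH, fact_simpl, mult_INR, RtoC_mult, RtoC_INR_S; ring.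
Qed.

Lemma GammaR_1 : GammaR 1 = 1.
Proof.
apply (GammaR_of_lim 1 1 (fun n => INR n / (INR n + 1))); [lra| |apply lim_ratio_shift; lra].
exists 1%nat; intros n Hn.
assert (HN : 0 < INR n) by (apply lt_0_INR; lia).
unfold gauss_prod; rewrite tpow_RtoC, Rpower_1, rising_1 by exact HN.
rewrite <- RtoC_mult, <- RtoC_div by apply INR_fact_neq_0.
f_equal; rewrite fact_simpl, mult_INR, S_INR; field; split; (lra || apply INR_fact_neq_0).
Qed.

Lemma rising_half n : rising (RtoC (1 / 2)) n = RtoC (INR (fact n) / wallis_prod n).
Proof.
induction n as [|n IH]; [simpl; f_equal; field|].
cbn [rising]; rewrite IH, <- RtoC_plus, <- RtoC_mult; f_equal.
rewrite fact_simpl, mult_INR, S_INR; cbn [wallis_prod].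
generalize (pos_INR n) (wallis_prod_pos n); intros; field; repeat split; lra.
Qed.

Lemma GammaR_half : GammaR (1 / 2) = sqrt PI.
Proof.
apply (GammaR_of_lim (1 / 2) (sqrt PI)
  (fun n => wallis_prod n / sqrt (INR n) * (INR n / (INR n + 1 / 2)))); [lra| |].
- exists 1%nat; intros n Hn.
  assert (HN : 0 < INR n) by (apply lt_0_INR; lia).
  assert (HS : 0 < sqrt (INR n)) by (apply sqrt_lt_R0, HN).
  assert (HP := wallis_prod_pos n).
  assert (HF := INR_fact_neq_0 n).
  unfold gauss_prod; cbn [rising].
  rewrite tpow_RtoC, rising_half, <- RtoC_plus, <- !RtoC_mult.
  replace (1 / 2) with (/ 2) at 1 by field; rewrite Rpower_sqrt by exact HN.
  assert (HD : INR (fact n) / wallis_prod n * (1 / 2 + INR n) <> 0).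
  { apply Rmult_integral_contrapositive_currified; [|lra].
    apply Rmult_integral_contrapositive_currified; [exact HF|].
    apply Rinv_neq_0_compat; lra. }
  rewrite <- RtoC_div by exact HD; f_equal.
  replace (INR n) with (sqrt (INR n) * sqrt (INR n)) at 4 by (apply sqrt_sqrt; lra).
  field; repeat split; lra.
- replace (Finite (sqrt PI)) with (Finite (sqrt PI * 1)) by (f_equal; ring).
  apply is_lim_seq_mult'; [apply wallis_limit | apply lim_ratio_shift; lra].
Qed.

Lemma GammaR_nat_pos k : 0 < GammaR (INR (S k)).
Proof.
induction k as [|k IH]; [change (INR 1) with 1; rewrite GammaR_1; lra|].
rewrite (S_INR (S k)), GammaR_S by (apply lt_0_INR; lia).
apply Rmult_lt_0_compat; auto; apply lt_0_INR; lia.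
Qed.

Lemma wallis_const_Gamma k :
  (2 * INR k + 1) * wallis_const k =
  sqrt PI * GammaR (INR (S k) + 1 / 2) / GammaR (INR (S k)).
Proof.
induction k as [|k IH].
- change (INR 1) with 1; replace (1 + 1 / 2) with (1 / 2 + 1) by ring.
  rewrite GammaR_S, GammaR_half, GammaR_1 by lra; simpl.
  replace (sqrt PI * (1 / 2 * sqrt PI) / 1) with (sqrt PI * sqrt PI / 2) by field.
  rewrite sqrt_sqrt by (generalize PI_RGT_0; lra); lra.
- assert (HP := GammaR_nat_pos k).
  assert (Hk := pos_INR k).
  assert (HS : 0 < INR (S k)) by (apply lt_0_INR; lia).
  rewrite (S_INR (S k)).
  replace (INR (S k) + 1 + 1 / 2) with (INR (S k) + 1 / 2 + 1) by ring.
  rewrite !GammaR_S by lra.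
  replace (sqrt PI * ((INR (S k) + 1 / 2) * GammaR (INR (S k) + 1 / 2)) /
    (INR (S k) * GammaR (INR (S k)))) with
    ((INR (S k) + 1 / 2) / INR (S k) *
     (sqrt PI * GammaR (INR (S k) + 1 / 2) / GammaR (INR (S k))))
    by (field; lra).
  rewrite <- IH; cbn [wallis_const]; rewrite S_INR; field; lra.
Qed.

(** * The shifted approximants converge to log-Gamma *)

(** By a second-order estimate: along the segment from [n] to [n + z] the derivative of
    the logarithm differs from [1 / n] by at most [|z| / n^2]. *)
Lemma Clog_shift_lim z : 0 < Re z ->
  Clim (fun n => RtoC (INR n) * (Clog (z + RtoC (INR n)) - RtoC (ln (INR n))))%C z.
Proof.
intros Hz; apply (Clim_of_rate _ _ (Cmod z * Cmod z)); intros n Hn.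
assert (HN : 0 < INR n) by (apply lt_0_INR; lia).
set (N := INR n) in *.
assert (Hpos : forall s, 0 <= s -> 0 < Re (RtoC N + RtoC s * z)%C).
{ intros s Hs; rewrite Re_plus, Re_mult; simpl; fold (Re z); nra. }
assert (HN0 : RtoC N <> 0%C) by (apply RtoC_neq_0; lra).
assert (B : Cmod ((Clog (RtoC N + RtoC 1 * z) - RtoC 1 * (z / RtoC N)) -
    (Clog (RtoC N + RtoC 0 * z) - RtoC 0 * (z / RtoC N))) <=
    Cmod z * Cmod z / (N * N) * 1 - Cmod z * Cmod z / (N * N) * 0).
{ apply (Cmean_value_le
    (fun s => Clog (RtoC N + RtoC s * z) - RtoC s * (z / RtoC N))%C
    (fun s => z / (RtoC N + RtoC s * z) - z / RtoC N)%C
    (fun s => Cmod z * Cmod z / (N * N) * s)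
    (fun _ => Cmod z * Cmod z / (N * N))); [lra| | |].
  - intros s Hs.
    assert (D : forall c, Cderiv (fun t => RtoC t * c)%C s c).
    { intros c; eapply Cderiv_eq.
      - apply (Cderiv_mult (fun t => RtoC t) (fun _ => c) s 1 0); [|apply Cderiv_const].
        apply (Cderiv_RtoC (fun t => t) s 1), (is_derive_id (K := R_AbsRing)).
      - ring. }
    apply Cderiv_minus; [|apply D].
    apply Cderiv_Clog; [apply Hpos; lra|].
    eapply Cderiv_eq; [apply Cderiv_plus; [apply Cderiv_const | apply D] | ring].
  - intros s _; auto_derive; auto; ring.
  - intros s Hs; specialize (Hpos s (proj1 Hs)).
    assert (H0 := Re_pos_neq_0 _ Hpos).
    replace (z / (RtoC N + RtoC s * z) - z / RtoC N)%C with
      (- (RtoC s * (z * z / (RtoC N * (RtoC N + RtoC s * z)))))%C by (field; auto).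
    rewrite Cmod_opp, Cmod_mult, Cmod_R, Rabs_pos_eq by lra.
    rewrite Cmod_div by (apply Cmult_neq_0; auto).
    rewrite !Cmod_mult, Cmod_R, (Rabs_pos_eq N) by lra.
    assert (HM : N <= Cmod (RtoC N + RtoC s * z)).
    { eapply Rle_trans; [|apply re_le_Cmod].
      rewrite Rabs_pos_eq by lra.
      rewrite Re_plus, Re_mult; simpl; fold (Re z); nra. }
    assert (HQ : Cmod z * Cmod z / (N * Cmod (RtoC N + RtoC s * z)) <= Cmod z * Cmod z / (N * N)).
    { apply Rmult_le_compat_l; [generalize (Cmod_ge_0 z); nra|].
      apply Rinv_le_contravar; nra. }
    assert (0 <= Cmod z * Cmod z / (N * Cmod (RtoC N + RtoC s * z))).
    { apply Rmult_le_pos; [generalize (Cmod_ge_0 z); nra|].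
      left; apply Rinv_0_lt_compat; nra. }
    nra. }
replace (RtoC N + RtoC 0 * z)%C with (RtoC N) in B by ring.
rewrite Clog_RtoC in B by exact HN.
replace (RtoC N + RtoC 1 * z)%C with (z + RtoC N)%C in B by ring.
replace (RtoC N * (Clog (z + RtoC N) - RtoC (ln N)) - z)%C with
  (RtoC N * ((Clog (z + RtoC N) - RtoC 1 * (z / RtoC N)) -
             (RtoC (ln N) - RtoC 0 * (z / RtoC N))))%C by (field; exact HN0).
rewrite Cmod_mult, Cmod_R, Rabs_pos_eq by lra.
replace (Cmod z * Cmod z / N) with
  (N * (Cmod z * Cmod z / (N * N) * 1 - Cmod z * Cmod z / (N * N) * 0)) by (field; lra).
apply Rmult_le_compat_l; [lra | exact B].
Qed.

Definition stirling_defect (n : nat) : R :=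
  ln (INR (fact n)) - (INR n + 1 / 2) * ln (INR n) + INR n.

Lemma Im_Csum_real f n : (forall j, f j = RtoC (Re (f j))) -> Im (Csum f n) = 0.
Proof.
intros H; induction n as [|n IH]; [reflexivity|].
cbn [Csum]; rewrite Im_plus, IH, H; simpl; ring.
Qed.

Lemma Csum_ln_fact n :
  Csum (fun m => Clog (1 + RtoC (INR m))) n = RtoC (ln (INR (fact n))).
Proof.
induction n as [|n IH]; [simpl; rewrite ln_1; reflexivity|].
cbn [Csum]; rewrite IH, fact_simpl, mult_INR, <- RtoC_plus.
generalize (pos_INR n); intros.
rewrite Clog_RtoC by lra.
rewrite ln_mult, S_INR, <- RtoC_plus by (apply INR_fact_lt_0 || (apply lt_0_INR; lia)).
f_equal; rewrite (Rplus_comm 1); ring.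
Qed.

Lemma ln_sqrt_half x : 0 < x -> ln (sqrt x) = 1 / 2 * ln x.
Proof.
intros Hx; rewrite <- (sqrt_sqrt x) at 2 by lra.
rewrite ln_mult by (apply sqrt_lt_R0, Hx); field.
Qed.

(** The Stirling defect converges because the approximants at [z = 1] do; comparing
    the indices [n] and [2 n] identifies the limit through the Wallis product. *)
Lemma stirling_defect_lim : is_lim_seq stirling_defect (1 / 2 * ln (2 * PI)).
Proof.
destruct stirling_shift_Cauchy as [K HK].
assert (H1 : 0 < Re (RtoC 1)) by (simpl; lra).
destruct (Clim_Cauchy_rate (fun n => stirling_shift n 1) K) as [l [[Hl _] _]].
{ intros N M HNM; apply HK; auto. }
destruct (Clog_shift_lim 1 H1) as [HL _].
assert (Hex : is_lim_seq stirling_defect (1 - Re l + 1 / 2 * (0 * 1) - 1)).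
{ apply is_lim_seq_ext_loc with (fun n =>
    Re (RtoC (INR n) * (Clog (1 + RtoC (INR n)) - RtoC (ln (INR n))))%C
    - Re (stirling_shift n 1)
    + (1 / 2) * (/ INR n * Re (RtoC (INR n) * (Clog (1 + RtoC (INR n)) - RtoC (ln (INR n))))%C)
    - 1).
  - exists 1%nat; intros n Hn.
    assert (HN : 0 < INR n) by (apply lt_0_INR; lia).
    unfold stirling_shift, stirling_lead, stirling_defect; rewrite Csum_ln_fact.
    rewrite <- RtoC_plus, Clog_RtoC by lra.
    repeat rewrite <- ?RtoC_minus, <- ?RtoC_mult; simpl.
    field; lra.
  - apply is_lim_seq_minus'; [|apply is_lim_seq_const].
    apply is_lim_seq_plus'; [apply is_lim_seq_minus'; [exact HL | exact Hl]|].
    apply is_lim_seq_mult'; [apply is_lim_seq_const|].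
    apply is_lim_seq_mult'; [apply is_lim_seq_inv_INR | exact HL]. }
set (L := 1 - Re l + 1 / 2 * (0 * 1) - 1) in *.
enough (E : L = 1 / 2 * ln (2 * PI)) by (rewrite <- E; exact Hex).
assert (H2 : is_lim_seq (fun n => 2 * stirling_defect n - stirling_defect (2 * n)) L).
{ replace L with (2 * L - L) by ring.
  apply is_lim_seq_minus'.
  - apply is_lim_seq_mult'; [apply is_lim_seq_const | exact Hex].
  - apply (is_lim_seq_subseq stirling_defect L (fun n => (2 * n)%nat)); [|exact Hex].
    intros P [N HP]; exists N; intros n Hn; apply HP; lia. }
assert (HPI := PI_RGT_0).
assert (HsP : 0 < sqrt PI) by (apply sqrt_lt_R0, HPI).
assert (H3 : is_lim_seq (fun n => ln (wallis_prod n / sqrt (INR n)) + 1 / 2 * ln 2)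
  (ln (sqrt PI) + 1 / 2 * ln 2)).
{ apply is_lim_seq_plus'; [|apply is_lim_seq_const].
  apply (is_lim_seq_cont ln); [|apply wallis_limit].
  apply (is_derive_cont ln _ (/ sqrt PI)), is_derive_ln, HsP. }
assert (H4 : is_lim_seq (fun n => 2 * stirling_defect n - stirling_defect (2 * n))
  (ln (sqrt PI) + 1 / 2 * ln 2)).
{ eapply is_lim_seq_ext_loc; [|exact H3].
  exists 1%nat; intros n Hn; unfold stirling_defect.
  assert (HN : 0 < INR n) by (apply lt_0_INR; lia).
  assert (HF1 := INR_fact_lt_0 n); assert (HF2 := INR_fact_lt_0 (2 * n)).
  rewrite ln_div by (apply wallis_prod_pos || (apply sqrt_lt_R0, HN)).
  rewrite wallis_prod_fact, ln_div.
  2:{ apply Rmult_lt_0_compat; [apply pow_lt; lra | apply Rmult_lt_0_compat; assumption]. }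
  2:{ exact HF2. }
  rewrite !ln_mult by (try apply pow_lt; try apply Rmult_lt_0_compat; lra).
  rewrite ln_pow, ln_sqrt_half by lra.
  replace (ln 4) with (2 * ln 2)
    by (replace 4 with (2 * 2) by ring; rewrite ln_mult by lra; ring).
  rewrite mult_INR; change (INR 2) with 2; rewrite (ln_mult 2) by lra.
  field. }
apply is_lim_seq_unique in H2; apply is_lim_seq_unique in H4.
rewrite H2 in H4; injection H4; intros ->.
rewrite ln_sqrt_half, ln_mult by lra; field.
Qed.

Lemma Cexp_Csum_Clog z n : 0 < Re z ->
  Cexp (Csum (fun m => Clog (z + RtoC (INR m))) n) = rising z n.
Proof.
intros Hz; induction n as [|n IH]; [simpl; apply Cexp_0|].
cbn [Csum rising]; rewrite Cexp_plus, IH, Cexp_Clog; auto.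
rewrite Re_shift; generalize (pos_INR n); lra.
Qed.

Lemma Cexp_stirling_shift_lim z : 0 < Re z ->
  Clim (fun n => Cexp (stirling_shift n z + RtoC (1 / 2 * ln (2 * PI)))) (Gamma z).
Proof.
intros Hz.
set (c := 1 / 2 * ln (2 * PI)).
set (lam := fun n => (RtoC (INR n) * (Clog (z + RtoC (INR n)) - RtoC (ln (INR n))))%C).
set (eps := fun n => ((lam n - z) + (z + RtoC (1 / 2)) * (RtoC (/ INR n) * lam n)
  + (RtoC c - RtoC (stirling_defect n)))%C).
apply Clim_ext_eventually with (fun n => gauss_prod z n * Cexp (eps n))%C.
- exists 1%nat; intros n Hn.
  assert (HN : 0 < INR n) by (apply lt_0_INR; lia).
  assert (Hw : 0 < Re (z + RtoC (INR n))%C) by (rewrite Re_shift; lra).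
  assert (E : eps n = (stirling_lead (z + RtoC (INR n)) + RtoC c + Clog (z + RtoC (INR n))
    - RtoC (ln (INR (fact n))) - z * RtoC (ln (INR n)))%C).
  { unfold eps, lam, stirling_lead, stirling_defect.
    assert (H0 : RtoC (INR n) <> 0%C) by (apply RtoC_neq_0; lra).
    rewrite RtoC_inv, !RtoC_plus, !RtoC_minus, !RtoC_mult, !RtoC_plus by lra.
    assert (Hh : (RtoC (1 / 2) + RtoC (1 / 2))%C = RtoC 1)
      by (rewrite <- RtoC_plus; f_equal; field).
    set (h := RtoC (1 / 2)) in *.
    replace (z + h)%C with (z - h + 1)%C by (rewrite <- Hh; ring).
    replace (RtoC (INR n) + h)%C with (RtoC (INR n) - h + 1)%C by (rewrite <- Hh; ring).
    field; exact H0. }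
  rewrite E, !Cexp_minus, !Cexp_plus, (Cexp_RtoC (ln _)), exp_ln by apply INR_fact_lt_0.
  rewrite Cexp_Clog by exact Hw.
  fold (tpow z (INR n)).
  unfold stirling_shift; rewrite Cexp_minus, Cexp_Csum_Clog by exact Hz.
  unfold gauss_prod; cbn [rising].
  assert (H1 := rising_neq_0 z n Hz).
  assert (H2 := RtoC_neq_0 _ (INR_fact_neq_0 n)).
  assert (H3 := Re_pos_neq_0 _ Hw).
  assert (H4 : tpow z (INR n) <> 0%C) by apply Cexp_neq_0.
  field; auto.
- replace (Gamma z) with (Gamma z * Cexp 0)%C by (rewrite Cexp_0; ring).
  apply Clim_mult; [apply Gamma_Gauss, Hz|].
  apply Clim_Cexp.
  assert (HL : Clim lam z) by apply Clog_shift_lim, Hz.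
  replace (RtoC 0) with ((z - z) + (z + RtoC (1 / 2)) * (RtoC 0 * z) + (RtoC c - RtoC c))%C by ring.
  unfold eps; apply Clim_plus; [apply Clim_plus|].
  + apply Clim_minus; [exact HL | apply Clim_const].
  + apply Clim_mult; [apply Clim_const|].
    apply Clim_mult; [apply Clim_RtoC, is_lim_seq_inv_INR | exact HL].
  + apply Clim_minus; [apply Clim_const | apply Clim_RtoC, stirling_defect_lim].
Qed.

(** * Identification of the branch *)

Lemma ex_derive_eps_delta (f : C -> C) z :
  ex_derive (K := C_AbsRing) (V := C_NormedModule) f z ->
  forall eps, 0 < eps -> exists d, 0 < d /\
    forall w, Cmod (w - z) < d -> Cmod (f w - f z) < eps.
Proof.
intros Hf eps Heps.
apply (ex_derive_continuous (K := C_AbsRing) (V := C_NormedModule)) in Hf.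
assert (He : 0 < eps / 2) by lra.
destruct (Hf (fun y => Rabs (Re y - Re (f z)) < eps / 2 /\ Rabs (Im y - Im (f z)) < eps / 2))
  as [d Hd].
{ exists (mkposreal _ He); intros y [Hy1 Hy2]; split; assumption. }
exists d; split; [apply cond_pos|]; intros w Hw.
destruct (Hd w Hw) as [H1 H2].
eapply Rle_lt_trans; [apply Cmod_le_Re_Im|]; rewrite Re_minus, Im_minus; lra.
Qed.

Lemma Clim_comp (f : C -> C) u z :
  ex_derive (K := C_AbsRing) (V := C_NormedModule) f z ->
  Clim u z -> Clim (fun n => f (u n)) (f z).
Proof.
intros Hf Hu; apply Clim_of_Cmod, is_lim_seq_spec; intros eps.
destruct (ex_derive_eps_delta f z Hf eps (cond_pos eps)) as [d [Hd HD]].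
assert (HL := Clim_Cmod _ _ (Clim_minus _ _ _ _ Hu (Clim_const z))).
replace (z - z)%C with (RtoC 0) in HL by ring; rewrite Cmod_0 in HL.
apply is_lim_seq_spec in HL; destruct (HL (mkposreal d Hd)) as [N HN].
exists N; intros n Hn; specialize (HN n Hn); simpl in HN.
rewrite Rminus_0_r, Rabs_pos_eq in * by apply Cmod_ge_0; auto.
Qed.

Definition vertical (x y s : R) : C := (x, s * y).

Lemma vertical_cont (f : C -> C) x y s :
  ex_derive (K := C_AbsRing) (V := C_NormedModule) f (vertical x y s) ->
  continuity_pt (fun t => Im (f (vertical x y t))) s.
Proof.
intros Hf; apply continuity_pt_filterlim; intros P [eps HP].
destruct (ex_derive_eps_delta f _ Hf eps (cond_pos eps)) as [d [Hd HD]].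
assert (Hy : 0 < Rabs y + 1) by (generalize (Rabs_pos y); lra).
exists (mkposreal _ (Rdiv_lt_0_compat _ _ Hd Hy)); intros t Ht; apply HP.
change (Rabs (t - s) < d / (Rabs y + 1)) in Ht.
change (Rabs (Im (f (vertical x y t)) - Im (f (vertical x y s))) < eps).
rewrite <- Im_minus; eapply Rle_lt_trans; [apply im_le_Cmod|]; apply HD.
eapply Rle_lt_trans; [apply Cmod_le_Re_Im|].
rewrite Re_minus, Im_minus; unfold vertical; simpl.
rewrite Rminus_diag, Rabs_R0, Rplus_0_l, <- Rmult_minus_distr_r, Rabs_mult.
apply Rle_lt_trans with (Rabs (t - s) * (Rabs y + 1)).
- apply Rmult_le_compat_l; [apply Rabs_pos | lra].
- apply Rmult_lt_reg_r with (/ (Rabs y + 1)); [apply Rinv_0_lt_compat, Hy|].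
  rewrite Rmult_assoc, Rinv_r, Rmult_1_r by lra; exact Ht.
Qed.

Lemma stirling_shift_vertical_cont N x y s : 0 < x ->
  continuity_pt (fun t => Im (stirling_shift N (vertical x y t))) s.
Proof.
intros Hx.
assert (D0 : forall n, Cderiv (fun t => vertical x y t + RtoC (INR n))%C s (0, y)).
{ intros n; split; unfold vertical; simpl; auto_derive; auto; ring. }
assert (DL : forall n, exists l, Cderiv (fun t => Clog (vertical x y t + RtoC (INR n))%C) s l).
{ intros n; eexists; apply Cderiv_Clog; [|apply D0].
  rewrite Re_shift; simpl; generalize (pos_INR n); lra. }
assert (DS : forall n, exists l,
  Cderiv (fun t => Csum (fun m => Clog (vertical x y t + RtoC (INR m))%C) n) s l).
{ induction n as [|n [l IH]].
  - exists 0%C; apply (Cderiv_ext (fun _ => 0%C)); [reflexivity | apply Cderiv_const].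
  - destruct (DL n) as [l' Hl']; exists (l + l')%C.
    apply (Cderiv_plus (fun t => Csum (fun m => Clog (vertical x y t + RtoC (INR m))%C) n)
      (fun t => Clog (vertical x y t + RtoC (INR n))%C)); assumption. }
destruct (DS N) as [l1 H1]; destruct (DL N) as [l2 H2].
assert (D := Cderiv_minus _ _ _ _ _
  (Cderiv_minus _ _ _ _ _
    (Cderiv_mult _ _ _ _ _
      (Cderiv_minus _ _ _ _ _ (D0 N) (Cderiv_const (RtoC (1 / 2)) s)) H2) (D0 N)) H1).
apply continuity_pt_filterlim; exact (proj2 (Cderiv_cont _ _ _ D)).
Qed.

Lemma is_lim_seq_0_of_zero u (l : R) : (forall n, u n = 0) -> is_lim_seq u l -> l = 0.
Proof.
intros H Hu; apply (is_lim_seq_ext _ (fun _ => 0) _ H), is_lim_seq_unique in Hu.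
rewrite Lim_seq_const in Hu; injection Hu; auto.
Qed.

Lemma stirling_shift_real N x : 0 < x -> Im (stirling_shift N (RtoC x)) = 0.
Proof.
intros Hx; unfold stirling_shift, stirling_lead.
assert (HL : forall n, Clog (RtoC x + RtoC (INR n)) = RtoC (ln (x + INR n))).
{ intros n; rewrite <- RtoC_plus; apply Clog_RtoC; generalize (pos_INR n); lra. }
rewrite Im_minus, Im_Csum_real, HL by (intros j; rewrite HL; reflexivity).
rewrite <- RtoC_plus, <- RtoC_minus, <- RtoC_mult, <- RtoC_minus; simpl; ring.
Qed.

(** The limit of the shifted approximants has the same exponential as log-Gamma, so
    they differ by a multiple of [2 i pi]. Along the vertical segment from the positive
    real axis to [z] the imaginary part of the difference lies within distance less
    than 1 of a continuous function that vanishes at the real end, so it stays 0. *)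
Lemma stirling_shift_lim (lnGamma : C -> C) z : is_lnGamma lnGamma -> 0 < Re z ->
  Clim (fun n => stirling_shift n z + RtoC (1 / 2 * ln (2 * PI)))%C (lnGamma z).
Proof.
intros [Hder [Hexp Hreal]] Hz.
set (c := RtoC (1 / 2 * ln (2 * PI))).
destruct stirling_shift_Cauchy as [K HK].
assert (HW : forall w, 0 < Re w -> exists l m,
  Clim (fun n => stirling_shift n w) l /\
  (forall N, (1 <= N)%nat -> Cmod (l - stirling_shift N w) <= K / INR N) /\
  Re (lnGamma w - (l + c))%C = 0 /\ Im (lnGamma w - (l + c))%C = 2 * PI * IZR m).
{ intros w Hw.
  destruct (Clim_Cauchy_rate (fun n => stirling_shift n w) K) as [l [Hl Hr]].
  { intros N M HNM; apply HK; auto. }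
  assert (E : Cexp (l + c) = Gamma w).
  { apply (Clim_unique (fun n => Cexp (stirling_shift n w + c))).
    - apply Clim_Cexp, Clim_plus; [exact Hl | apply Clim_const].
    - apply Cexp_stirling_shift_lim, Hw. }
  destruct (Cexp_eq_1 (lnGamma w - (l + c))) as [HR [m Hm]].
  { rewrite Cexp_minus, E, Hexp by (intros [_ H]; lra).
    rewrite <- E; field; apply Cexp_neq_0. }
  exists l, m; auto. }
set (x := Re z) in *; set (y := Im z).
(* A single index [N] makes the approximation error less than 1 on the whole segment. *)
destruct (INR_unbounded K) as [N0 HN0]; set (N := S N0).
assert (HN : K / INR N < 1).
{ assert (HKN : K < INR N) by (unfold N; rewrite S_INR; lra).
  assert (0 < INR N) by (apply lt_0_INR; unfold N; lia).
  apply Rmult_lt_reg_r with (INR N); auto.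
  unfold Rdiv; rewrite Rmult_assoc, Rinv_l by lra; lra. }
set (phi := fun s => Im (lnGamma (vertical x y s)) - Im (stirling_shift N (vertical x y s))).
assert (Hphi : forall s l m, Cmod (l - stirling_shift N (vertical x y s)) <= K / INR N ->
  Im (lnGamma (vertical x y s) - (l + c))%C = 2 * PI * IZR m ->
  Rabs (phi s - 2 * PI * IZR m) < 1).
{ intros s l m Hl Hm; rewrite <- Hm; unfold phi.
  rewrite Im_minus, Im_plus; unfold c; change (Im (RtoC (1 / 2 * ln (2 * PI)))) with 0.
  replace (_ - _) with (Im (l - stirling_shift N (vertical x y s))%C)
    by (rewrite Im_minus; ring).
  eapply Rle_lt_trans; [apply im_le_Cmod | lra]. }
assert (Hcont : continuity phi).
{ intros s; apply (continuity_pt_minus (fun s => Im (lnGamma (vertical x y s)))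
    (fun s => Im (stirling_shift N (vertical x y s)))).
  - apply vertical_cont, Hder; intros [_ H]; simpl in H; lra.
  - apply stirling_shift_vertical_cont; exact Hz. }
assert (HPI : 3 < PI) by (generalize PI2_3_2; unfold PI2; lra).
assert (H0 : Rabs (phi 0) < 1).
{ assert (Ev : vertical x y 0 = RtoC x) by (unfold vertical, RtoC; f_equal; ring).
  destruct (HW (RtoC x) Hz) as [l [m [Hl [Hr [HR HI]]]]].
  assert (Hl0 : Im l = 0).
  { apply (is_lim_seq_0_of_zero (fun n => Im (stirling_shift n (RtoC x)))); [|apply Hl].
    intros n; apply stirling_shift_real, Hz. }
  replace (phi 0) with (phi 0 - 2 * PI * IZR m).
  - apply (Hphi 0 l m); rewrite Ev; auto; apply Hr; unfold N; lia.
  - rewrite <- HI, Hreal, Im_minus, Im_plus, Hl0 by exact Hz; unfold c; simpl; ring. }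
(* The values 2 and -2 are at distance at least 1 from every multiple of [2 pi]. *)
assert (Hmid : forall s, phi s <> 2 /\ phi s <> -2).
{ intros s; destruct (HW (vertical x y s) Hz) as [l [m [Hl [Hr [HR HI]]]]].
  assert (B := Hphi s l m (Hr N ltac:(unfold N; lia)) HI).
  apply Rabs_def2 in B.
  assert (Hm : (m <= -1)%Z \/ m = 0%Z \/ (1 <= m)%Z) by lia.
  destruct Hm as [Hm | [-> | Hm]]; [apply IZR_le in Hm| |apply IZR_le in Hm];
    split; intros E; rewrite E in B; nra. }
assert (H1 : -2 < phi 1 < 2).
{ apply Rabs_def2 in H0; split; apply Rnot_le_lt; intros H.
  - destruct (IVT_gen phi 0 1 (-2) Hcont) as [s [_ Hs]].
    + rewrite Rmin_right, Rmax_left; lra.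
    + apply (proj2 (Hmid s) Hs).
  - destruct (IVT_gen phi 0 1 2 Hcont) as [s [_ Hs]].
    + rewrite Rmin_left, Rmax_right; lra.
    + apply (proj1 (Hmid s) Hs). }
assert (Ez : vertical x y 1 = z).
{ unfold vertical, x, y; destruct z; simpl; f_equal; ring. }
destruct (HW z Hz) as [l [m [Hl [Hr [HR HI]]]]].
assert (B := Hphi 1 l m); rewrite Ez in B.
specialize (B (Hr N ltac:(unfold N; lia)) HI); apply Rabs_def2 in B.
assert (Hm : (m <= -1)%Z \/ m = 0%Z \/ (1 <= m)%Z) by lia.
assert (m = 0%Z).
{ destruct Hm as [Hm | [-> | Hm]]; auto; apply IZR_le in Hm; nra. }
subst m.
replace (lnGamma z) with (l + c)%C.
- apply Clim_plus; [exact Hl | apply Clim_const].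
- apply C_eq.
  + rewrite Re_minus in HR; lra.
  + rewrite Im_minus in HI; lra.
Qed.

(** * The remainder bound *)

Lemma sum_n_m_stirling k z :
  sum_n_m (G := C_AbelianMonoid) (fun j => stirling_T j z) 1 k = stirling_sum k z.
Proof.
induction k as [|k IH].
- rewrite sum_n_m_zero by lia; reflexivity.
- rewrite sum_n_Sm by lia; rewrite IH; reflexivity.
Qed.

Lemma stirling_R_eq (lnGamma : C -> C) k z :
  stirling_R lnGamma (S k) z =
  (lnGamma z - RtoC (1 / 2 * ln (2 * PI)) - (stirling_lead z + stirling_sum k z))%C.
Proof.
unfold stirling_R; replace (S k - 1)%nat with k by lia.
rewrite sum_n_m_stirling; unfold stirling_lead; ring.
Qed.

Lemma stirling_R_step (lnGamma : C -> C) k z :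
  stirling_R lnGamma (S k) z = (stirling_R lnGamma (S (S k)) z + stirling_T (S k) z)%C.
Proof.
rewrite !stirling_R_eq.
change (stirling_sum (S k) z) with (stirling_sum k z + stirling_T (S k) z)%C; ring.
Qed.

Lemma Cmod_stirling_T_wallis k (z : C) : z <> 0%C ->
  (2 * INR k + 1) * wallis_const k * Cmod (stirling_T (S k) z) =
  Rabs (bernoulli (2 * S k)) / INR (2 * S k) * (wallis_const k / Cmod z ^ (2 * k + 1)).
Proof.
intros Hz; rewrite Cmod_stirling_T by exact Hz.
replace (2 * S k - 1)%nat with (2 * k + 1)%nat by lia.
assert (Hk := pos_INR k).
replace (INR (2 * k + 1)) with (2 * INR k + 1)
  by (rewrite plus_INR, mult_INR; reflexivity).
assert (H1 : INR (2 * S k) <> 0) by (apply not_0_INR; lia).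
assert (H2 : 0 < Cmod z ^ (2 * k + 1)) by (apply pow_lt, Cmod_gt_0, Hz).
field; repeat split; lra.
Qed.

Lemma stirling_R_bound_open (lnGamma : C -> C) k z : is_lnGamma lnGamma -> 0 < Re z ->
  Cmod (stirling_R lnGamma (S (S k)) z) <=
  (2 * INR k + 1) * wallis_const k * Cmod (stirling_T (S k) z).
Proof.
intros Hln Hz.
assert (H0 := Re_pos_neq_0 z Hz).
rewrite Cmod_stirling_T_wallis by exact H0.
set (b := Rabs (bernoulli (2 * S k)) / INR (2 * S k)).
assert (Hb : 0 <= b).
{ apply Rmult_le_pos; [apply Rabs_pos | left; apply Rinv_0_lt_compat, lt_0_INR; lia]. }
destruct (wallis_primitive (Cmod z) k) as [G [d [HG Hd]]]; [apply Cmod_gt_0, H0|].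
set (c := RtoC (1 / 2 * ln (2 * PI))).
assert (HL : Clim (fun n => stirling_approx (S k) n z - stirling_approx (S k) 0 z)%C
  (stirling_R lnGamma (S (S k)) z)).
{ assert (HS : Clim (fun n => stirling_sum (S k) (z + RtoC (INR n))) 0).
  { destruct (stirling_sum_shift_rate (S k)) as [K [_ HK]].
    apply (Clim_of_rate _ _ K); intros n Hn.
    replace (_ - 0)%C with (stirling_sum (S k) (z + RtoC (INR n))) by ring.
    apply HK; auto. }
  assert (X := Clim_plus _ _ _ _ (Clim_minus _ _ _ _
    (stirling_shift_lim lnGamma z Hln Hz)
    (Clim_const (c + (stirling_lead z + stirling_sum (S k) z))%C)) HS).
  rewrite stirling_R_eq.
  replace (lnGamma z - RtoC (1 / 2 * ln (2 * PI)) - (stirling_lead z + stirling_sum (S k) z))%C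
    with (lnGamma z - (c + (stirling_lead z + stirling_sum (S k) z)) + 0)%C
    by (unfold c; ring).
  eapply Clim_ext; [|exact X].
  intros n; simpl; unfold stirling_approx, stirling_shift at 3; fold c; simpl.
  replace (z + RtoC 0)%C with z by ring; ring. }
apply Clim_Cmod in HL.
assert (HR : is_lim_seq (fun n => b * (wallis_const k / Cmod z ^ (2 * k + 1) + d * / INR n))
  (b * (wallis_const k / Cmod z ^ (2 * k + 1)))).
{ set (W := wallis_const k / Cmod z ^ (2 * k + 1)).
  replace (Finite (b * W)) with (Finite (b * (W + d * 0))) by (f_equal; ring).
  apply is_lim_seq_mult'; [apply is_lim_seq_const|].
  apply is_lim_seq_plus'; [apply is_lim_seq_const|].
  apply is_lim_seq_mult'; [apply is_lim_seq_const | apply is_lim_seq_inv_INR]. }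
apply (lim_le _ _ _ _ HL HR); exists 1%nat; intros n Hn.
eapply Rle_trans; [apply (stirling_approx_diff k 0 n z G); auto; lia|].
fold b; apply Rmult_le_compat_l; auto.
apply Hd, lt_0_INR; lia.
Qed.

(** ** The imaginary axis *)

Lemma Clim_inv (u : nat -> C) (l : C) : l <> 0%C -> Clim u l -> Clim (fun n => / u n)%C (/ l)%C.
Proof.
intros Hl [H1 H2].
assert (HM : Re l ^ 2 + Im l ^ 2 <> 0).
{ rewrite <- Cmod2_alt; apply Rgt_not_eq, pow_lt, Cmod_gt_0, Hl. }
assert (HD : is_lim_seq (fun n => Re (u n) ^ 2 + Im (u n) ^ 2) (Re l ^ 2 + Im l ^ 2)).
{ apply is_lim_seq_plus'; apply is_lim_seq_sqr; assumption. }
split.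
- apply (is_lim_seq_div' (fun n => Re (u n)) _ (Re l) _ H1 HD HM).
- apply (is_lim_seq_div' (fun n => - Im (u n)) _ (- Im l) _); auto.
  apply (is_lim_seq_opp (fun n => Im (u n)) (Im l)), H2.
Qed.

Lemma Clim_pow u l m : Clim u l -> Clim (fun n => u n ^ m)%C (l ^ m)%C.
Proof.
intros H; induction m as [|m IH]; [apply Clim_const|].
rewrite Cpow_S; apply (Clim_mult u (fun n => u n ^ m)%C); assumption.
Qed.

Lemma Clim_stirling_T j u (l : C) : l <> 0%C -> Clim u l ->
  Clim (fun n => stirling_T (S j) (u n)) (stirling_T (S j) l).
Proof.
intros Hl Hu; unfold stirling_T, Cdiv.
apply Clim_mult; [apply Clim_const|].
apply Clim_inv.
- apply Cmult_neq_0; [|apply Cpow_nz, Hl].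
  apply Cmult_neq_0; apply RtoC_INR_neq_0; lia.
- apply Clim_mult; [apply Clim_const | apply Clim_pow, Hu].
Qed.

Lemma Clim_stirling_sum k u (l : C) : l <> 0%C -> Clim u l ->
  Clim (fun n => stirling_sum k (u n)) (stirling_sum k l).
Proof.
intros Hl Hu; unfold stirling_sum; induction k as [|k IH]; cbn [Csum].
- apply Clim_const.
- apply Clim_plus; [exact IH | apply Clim_stirling_T; assumption].
Qed.

Lemma Clim_shift_inv z : Clim (fun n => z + RtoC (/ INR n))%C z.
Proof.
assert (H := Clim_plus _ _ _ _ (Clim_const z) (Clim_RtoC _ _ is_lim_seq_inv_INR)).
replace (z + RtoC 0)%C with z in H by ring; exact H.
Qed.

(** The imaginary part is constant along a horizontal approach, so the two cases in the
    principal argument do not mix. *)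
Lemma Clim_Clog_imaginary (z : C) : Re z = 0 -> z <> 0%C ->
  Clim (fun n => Clog (z + RtoC (/ INR n))) (Clog z).
Proof.
intros Hz H0.
assert (HM : 0 < Cmod z) by (apply Cmod_gt_0, H0).
assert (Hu := Clim_shift_inv z).
assert (HC := Clim_Cmod _ _ Hu).
assert (HA : is_lim_seq (fun n => acos (Re (z + RtoC (/ INR n))%C / Cmod (z + RtoC (/ INR n))))
  (acos (Re z / Cmod z))).
{ apply (is_lim_seq_cont acos).
  - rewrite Hz; unfold Rdiv; rewrite Rmult_0_l.
    apply continuity_pt_filterlim, derivable_continuous_pt, derivable_pt_acos; lra.
  - apply is_lim_seq_div'; [apply Hu | exact HC | lra]. }
split.
- apply (is_lim_seq_cont ln); [|exact HC].
  apply (is_derive_cont ln _ (/ Cmod z)), is_derive_ln, HM.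
- unfold Clog; simpl; unfold Carg.
  destruct (Rle_dec 0 (Im z)) as [Hi|Hi].
  + eapply is_lim_seq_ext; [|exact HA]; intros n; cbn beta.
    destruct Rle_dec as [|Hn]; [reflexivity|]; rewrite Im_shift in Hn; tauto.
  + apply is_lim_seq_ext with
      (fun n => - acos (Re (z + RtoC (/ INR n))%C / Cmod (z + RtoC (/ INR n)))).
    * intros n; destruct Rle_dec as [Hn|]; [|reflexivity].
      rewrite Im_shift in Hn; tauto.
    * apply (is_lim_seq_opp _ (acos (Re z / Cmod z))), HA.
Qed.

Lemma stirling_R_bound (lnGamma : C -> C) k (z : C) :
  is_lnGamma lnGamma -> 0 <= Re z -> z <> 0%C ->
  Cmod (stirling_R lnGamma (S (S k)) z) <=
  (2 * INR k + 1) * wallis_const k * Cmod (stirling_T (S k) z).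
Proof.
intros Hln Hz H0.
destruct Hz as [Hz | Hz]; [apply stirling_R_bound_open; assumption|].
symmetry in Hz.
set (u := fun n => (z + RtoC (/ INR n))%C).
assert (Hu : Clim u z) by apply Clim_shift_inv.
assert (HR : Clim (fun n => stirling_R lnGamma (S (S k)) (u n)) (stirling_R lnGamma (S (S k)) z)).
{ rewrite stirling_R_eq.
  eapply Clim_ext; [intros n; symmetry; apply stirling_R_eq|].
  apply Clim_minus; [apply Clim_minus; [|apply Clim_const] | apply Clim_plus].
  - apply (Clim_comp lnGamma u z); [|exact Hu].
    apply (proj1 Hln); intros [Hi _]; apply H0, C_eq; assumption.
  - unfold stirling_lead; apply Clim_minus; [|exact Hu].
    apply Clim_mult; [apply Clim_minus; [exact Hu | apply Clim_const]|].
    apply Clim_Clog_imaginary; assumption.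
  - apply Clim_stirling_sum; assumption. }
assert (HT := Clim_Cmod _ _ (Clim_stirling_T k u z H0 Hu)).
apply (lim_le _ _ _ _ (Clim_Cmod _ _ HR)
  (is_lim_seq_mult' _ _ _ _ (is_lim_seq_const ((2 * INR k + 1) * wallis_const k)) HT)).
exists 1%nat; intros n Hn; apply stirling_R_bound_open; auto.
unfold u; rewrite Re_shift, Hz.
assert (0 < / INR n) by (apply Rinv_0_lt_compat, lt_0_INR; lia); lra.
Qed.

Theorem theorem1 (lnGamma : C -> C) (HlnGamma : is_lnGamma lnGamma)
    (k : nat) (Hk : (1 <= k)%nat) (z : C) (Hz : 0 <= Re z) (Hz0 : z <> RtoC 0) :
  Cmod (stirling_R lnGamma (k + 1) z) <=
    sqrt PI * GammaR (INR k + 1 / 2) / GammaR (INR k) * Cmod (stirling_T k z) /\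
  Cmod (stirling_R lnGamma k z) <=
    (sqrt PI * GammaR (INR k + 1 / 2) / GammaR (INR k) + 1) * Cmod (stirling_T k z).
Proof.
destruct k as [|k]; [lia|].
rewrite Nat.add_1_r, <- wallis_const_Gamma.
assert (B := stirling_R_bound lnGamma k z HlnGamma Hz Hz0).
split; [exact B|].
rewrite stirling_R_step.
eapply Rle_trans; [apply Cmod_triangle | lra].
Qed.
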